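(* Let $\mathbb{A}$ be a strict monoidal category with free cornering ${}^\ulcorner_\llcorner\mathbb{A}^\urcorner_\lrcorner$. Then the category $\mathsf{Optic}_{\mathbb{A}}$ of optics in $\mathbb{A}$ is the full subcategory of the category $\mathbf{H}\,{}^\ulcorner_\llcorner\mathbb{A}^\urcorner_\lrcorner$ of horizontal cells on the objects of the form $A^\circ \otimes B^\bullet$ with $A, B$ objects of $\mathbb{A}$; that is, there is an isomorphism of categories from $\mathsf{Optic}_{\mathbb{A}}$ to this full subcategory which sends the object $(A,B)$ to $A^\circ \otimes B^\bullet$.
   Context: Conventions. Composition of arrows in $\mathbb{A}$ is written in diagrammatic order: $fg$ means first $f$, then $g$. All monoidal categories are strict; $\mathbb{A}_0$ is the set of objects of $\mathbb{A}$ and $I$ is the unit. Optics. $\mathsf{Optic}_{\mathbb{A}}$ has as objects pairs $(A,B)$ of objects of $\mathbb{A}$. An arrow $(A,B)\to(C,D)$ is represented by $\langle \alpha \mid \beta\rangle_M$ where $M\in\mathbb{A}_0$, $\alpha : A\to M\otimes C$ and $\beta : M\otimes D\to B$ in $\mathbb{A}$; arrows are equivalence classes of such data under the equivalence relation generated by $\langle \alpha(f\otimes 1_C)\mid\beta\rangle_N = \langle\alpha\mid(f\otimes 1_D)\beta\rangle_M$ for all $f : M\to N$, $\alpha : A\to M\otimes C$, $\beta : N\otimes D\to B$. (Equivalently, the hom-set is $\int^{M}\mathbb{A}(A,M\otimes C)\times\mathbb{A}(M\otimes D,B)$.) Composition is $\langle\alpha\mid\beta\rangle_M\langle\gamma\mid\delta\rangle_N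 = \langle\alpha(1_M\otimes\gamma)\mid(1_M\otimes\delta)\beta\rangle_{M\otimes N}$ and identities are $1_{(A,B)}=\langle 1_A\mid 1_B\rangle_I$. Single object double categories. A single object double category $\mathbb{D}$ is a double category with exactly one object. It consists of a horizontal edge monoid $(\mathbb{D}_H,\otimes,I)$, a vertical edge monoid $(\mathbb{D}_V,\otimes,I)$, and for all $A,B\in\mathbb{D}_H$, $X,Y\in\mathbb{D}_V$ a set $\mathbb{D}\left(X\,{A\atop B}\,Y\right)$ of cells with left boundary $X$, top boundary $A$, bottom boundary $B$, right boundary $Y$. Cells $\alpha\in\mathbb{D}\left(X\,{A\atop B}\,Y\right)$ and $\beta\in\mathbb{D}\left(Y\,{A'\atop B'}\,Z\right)$ have a horizontal composite $\alpha\vert\beta\in\mathbb{D}\left(X\,{A\otimes A'\atop B\otimes B'}\,Z\right)$; cells $\alpha\in\mathbb{D}\left(X\,{A\atop B}\,Y\right)$ and $\beta\in\mathbb{D}\left(X'\,{B\atop C}\,Y'\right)$ have a vertical composite $\frac{\alpha}{\beta}\in\mathbb{D}\left(X\otimes X'\,{A\atop C}\,Y\otimes Y'\right)$. Both compositions are associative and unital, with horizontal identity cells $\mathrm{id}_X\in\mathbb{D}\left(X\,{I\atop I}\,X\right)$ and vertical identity cells $1_A\in\mathbb{D}\left(I\,{A\atop A}\,I\right)$, compatible with the edge monoids as in any double category ($\mathrm{id}_{X\otimes Y}=\frac{\mathrm{id}_X}{\mathrm{id}_Y}$, $1_{A\otimes B}=1_A\vert 1_B$); the two identity cells of type $I$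 coincide; and the interchange law $\frac{\alpha}{\beta}\vert\frac{\gamma}{\delta}=\frac{\alpha\vert\gamma}{\beta\vert\delta}$ holds. Horizontal cells. $\mathbf{H}\,\mathbb{D}$ is the (strict monoidal) category whose objects are the elements of $\mathbb{D}_V$, whose arrows $X\to Y$ are the cells in $\mathbb{D}\left(X\,{I\atop I}\,Y\right)$, with composition given by horizontal composition of cells and tensor product given by vertical composition. Free cornering. The free cornering ${}^\ulcorner_\llcorner\mathbb{A}^\urcorner_\lrcorner$ of $\mathbb{A}$ is the free single object double category on the following data. Its horizontal edge monoid is $(\mathbb{A}_0,\otimes,I)$. Its vertical edge monoid is the free monoid on the set $\mathbb{A}_0\times\{\circ,\bullet\}$, whose generators are written $A^\circ$ and $A^\bullet$ (with monoid operation $\otimes$ and unit $I$). The generating cells are: (1) for each $f:A\to B$ in $\mathbb{A}$, a cell $\ulcorner f\urcorner$ with left and right boundary $I$, top $A$, bottom $B$, subject to $\ulcorner fg\urcorner=\frac{\ulcorner f\urcorner}{\ulcorner g\urcorner}$, $\ulcorner 1_A\urcorner=1_A$, and $\ulcorner f\otimes g\urcorner=\ulcorner f\urcorner\vert\ulcorner g\urcorner$; (2) for each $A\in\mathbb{A}_0$, four corner cells, written here as $s^\circ_A\in\left(I\,{A\atop I}\,A^\circ\right)$, $r^\circ_A\in\left(A^\circ\,{I\atop A}\,I\right)$, $r^\bullet_A\in\left(I\,{I\atop A}\,A^\bullet\right)$, $s^\bullet_A\in\left(A^\bullet\,{A\atop I}\,I\right)$ (boundaries listed as left, top over bottom, right),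 subject to the yanking equations $s^\circ_A\vert r^\circ_A=1_A$, $\frac{r^\circ_A}{s^\circ_A}=\mathrm{id}_{A^\circ}$, $r^\bullet_A\vert s^\bullet_A=1_A$, $\frac{r^\bullet_A}{s^\bullet_A}=\mathrm{id}_{A^\bullet}$. That is, cells are all formal horizontal and vertical composites of generating cells and identity cells, modulo the axioms of a double category and the listed equations. *)

(* Defs.v *)
From Stdlib Require Import Relations.
From mathcomp Require Import all_boot generic_quotient.
From mathcomp Require Import boolp.

Set Implicit Arguments.
Unset Strict Implicit.
Unset Printing Implicit Defensive.

Local Open Scope quotient_scope.

Section Quotient.
Variables (T : Type) (R : relation T).

(* [{eq_quot _}] needs a choiceType; [{classic T}] provides one for any [T]. *)
Definition gen_eq : rel {classic T} :=
  fun x y => `[< clos_refl_sym_trans T R x y >].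

Lemma gen_eq_refl : reflexive gen_eq.
Proof. by move=> x; apply/asboolP; apply: rst_refl. Qed.

Lemma gen_eq_sym : symmetric gen_eq.
Proof. by move=> x y; apply/asboolP/asboolP; apply: rst_sym. Qed.

Lemma gen_eq_trans : transitive gen_eq.
Proof.
by move=> y x z /asboolP xy /asboolP yz; apply/asboolP; apply: rst_trans xy yz.
Qed.

Canonical gen_eq_equiv := EquivRel gen_eq gen_eq_refl gen_eq_sym gen_eq_trans.

Definition quotient : Type := {eq_quot gen_eq_equiv}.

Definition cls (x : T) : quotient := \pi_{eq_quot gen_eq_equiv} x.

Definition rep (q : quotient) : T := repr (q : {eq_quot gen_eq_equiv}).

Lemma repK : cancel rep cls.
Proof. exact: reprK. Qed.

Lemma clsP (x y : T) : cls x = cls y <-> clos_refl_sym_trans T R x y.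
Proof.
rewrite /cls; split=> [/eqquotP/asboolP //|xy].
by apply/eqquotP/asboolP.
Qed.

Lemma rep_cls (x : T) : clos_refl_sym_trans T R (rep (cls x)) x.
Proof. by apply/clsP; rewrite repK. Qed.

End Quotient.

Arguments cls {T} R x.
Arguments rep {T R} q.

Lemma rst_map (T U : Type) (R : relation T) (S : relation U) (f : T -> U) :
  (forall x y, R x y -> S (f x) (f y)) ->
  forall x y, clos_refl_sym_trans T R x y ->
    clos_refl_sym_trans U S (f x) (f y).
Proof.
move=> fRS x y; elim=> {x y} [x y|x|x y _|x y z _ xy _].
- by move/fRS; apply: rst_step.
- exact: rst_refl.
- exact: rst_sym.
- exact: rst_trans xy.
Qed.

Declare Scope cat_scope.
Open Scope cat_scope.

Record category := Category {
  ob :> Type;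
  hom : ob -> ob -> Type;
  idm : forall A, hom A A;
  (* diagrammatic order: first [f], then [g] *)
  comp : forall A B C, hom A B -> hom B C -> hom A C;
  comp_assoc : forall A B C D (f : hom A B) (g : hom B C) (h : hom C D),
    comp (comp f g) h = comp f (comp g h);
  comp_idl : forall A B (f : hom A B), comp (idm A) f = f;
  comp_idr : forall A B (f : hom A B), comp f (idm B) = f }.

Arguments hom {c} _ _.
Arguments idm {c} _.
Arguments comp {c A B C} _ _.
Notation "f ;; g" := (comp f g) (at level 45, right associativity) : cat_scope.

Record functor (C D : category) := Functor {
  fob :> C -> D;
  fmap : forall A B : C, hom A B -> hom (fob A) (fob B);
  fmap_id : forall A : C, fmap (idm A) = idm (fob A);
  fmap_comp : forall (A B E : C) (f : hom A B) (g : hom B E),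
    fmap (f ;; g) = fmap f ;; fmap g }.

Definition functor_id (C : category) : functor C C :=
  @Functor C C id (fun _ _ f => f) (fun _ => erefl) (fun _ _ _ _ _ => erefl).

Section FunctorComp.
Variables (C D E : category) (F : functor C D) (G : functor D E).

Lemma functor_comp_id (A : C) :
  fmap G (fmap F (idm A)) = idm (G (F A)).
Proof. by rewrite !fmap_id. Qed.

Lemma functor_comp_comp (A B K : C) (f : hom A B) (g : hom B K) :
  fmap G (fmap F (f ;; g)) = fmap G (fmap F f) ;; fmap G (fmap F g).
Proof. by rewrite !fmap_comp. Qed.

Definition functor_comp : functor C E :=
  @Functor C E (fun A => G (F A)) (fun A B f => fmap G (fmap F f))
    functor_comp_id functor_comp_comp.
End FunctorComp.

Definition is_cat_iso (C D : category) (F : functor C D) : Prop :=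
  exists G : functor D C,
    functor_comp F G = functor_id C /\ functor_comp G F = functor_id D.

Definition full_subcategory (C : category) (P : C -> Prop) : category :=
  @Category {X : C | P X}
    (fun X Y => hom (sval X) (sval Y))
    (fun X => idm (sval X))
    (fun X Y Z f g => f ;; g)
    (fun _ _ _ _ f g h => comp_assoc f g h)
    (fun _ _ f => comp_idl f)
    (fun _ _ f => comp_idr f).

(* The total set of arrows.  The strictness laws relate arrows whose domains and
   codomains are only propositionally equal; they are equations in this set. *)
Record arrow (O : Type) (H : O -> O -> Type) := Arr {
  arr_dom : O; arr_cod : O; arr_hom : H arr_dom arr_cod }.
Arguments Arr {O H arr_dom arr_cod} _.

Definition cast (O : Type) (H : O -> O -> Type) (A A' B B' : O)
    (eA : A = A') (eB : B = B') (f : H A B) : H A' B' :=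
  let: erefl := eA in let: erefl := eB in f.
Arguments cast : simpl never.

Record strict_moncat := StrictMonCat {
  mcat :> category;
  ten : mcat -> mcat -> mcat;
  unit_ob : mcat;
  htens : forall A B C D : mcat,
    hom A B -> hom C D -> hom (ten A C) (ten B D);
  ten_assoc : forall A B C, ten (ten A B) C = ten A (ten B C);
  ten_unitl : forall A, ten unit_ob A = A;
  ten_unitr : forall A, ten A unit_ob = A;
  htens_id : forall A B, htens (idm A) (idm B) = idm (ten A B);
  htens_comp : forall (A B C A' B' C' : mcat) (f : hom A B) (g : hom B C)
      (f' : hom A' B') (g' : hom B' C'),
    htens (f ;; g) (f' ;; g') = htens f f' ;; htens g g';
  htens_assoc : forall (A B C D E F : mcat)
      (f : hom A B) (g : hom C D) (h : hom E F),
    Arr (htens (htens f g) h) = Arr (htens f (htens g h));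
  htens_unitl : forall (A B : mcat) (f : hom A B),
    Arr (htens (idm unit_ob) f) = Arr f;
  htens_unitr : forall (A B : mcat) (f : hom A B),
    Arr (htens f (idm unit_ob)) = Arr f }.

Arguments ten {s} _ _.
Arguments unit_ob {s}.
Arguments htens {s A B C D} _ _.
Notation "A ⊗ B" := (ten A B) (at level 40, left associativity) : cat_scope.
Notation "f ⊗₁ g" := (htens f g) (at level 40, left associativity) : cat_scope.

Section ArrowLemmas.

Lemma arr_inj (O : Type) (H : O -> O -> Type) (A B : O) (f g : H A B) :
  Arr f = Arr g -> f = g.
Proof.
have gen (x y : arrow H) (exy : x = y) (e1 : arr_dom x = arr_dom y)
    (e2 : arr_cod x = arr_cod y) : cast e1 e2 (arr_hom x) = arr_hom y.
  case: y / exy e1 e2 => e1 e2.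
  by rewrite (Prop_irrelevance e1 erefl) (Prop_irrelevance e2 erefl).
by move=> e; apply: (gen _ _ e erefl erefl).
Qed.

Lemma arr_cast (O : Type) (H : O -> O -> Type) (A A' B B' : O)
  (eA : A = A') (eB : B = B') (f : H A B) : Arr (cast eA eB f) = Arr f.
Proof. by case: A' / eA; case: B' / eB. Qed.

Lemma arr_comp (C : category) (A B D A' B' D' : C) (f : hom A B) (g : hom B D)
    (f' : hom A' B') (g' : hom B' D') :
  Arr f = Arr f' -> Arr g = Arr g' -> Arr (f ;; g) = Arr (f' ;; g').
Proof.
move=> ef eg; have eA : A = A' := congr1 (@arr_dom _ _) ef.
have eB : B = B' := congr1 (@arr_cod _ _) ef.
have eD : D = D' := congr1 (@arr_cod _ _) eg.
case: A' / eA f' ef => f' ef; case: B' / eB f' g' ef eg => f' g' ef eg.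
case: D' / eD g' eg => g' eg.
by rewrite (arr_inj ef) (arr_inj eg).
Qed.

Lemma arr_htens (M : strict_moncat) (A B C D A' B' C' D' : M)
    (f : hom A B) (g : hom C D) (f' : hom A' B') (g' : hom C' D') :
  Arr f = Arr f' -> Arr g = Arr g' -> Arr (f ⊗₁ g) = Arr (f' ⊗₁ g').
Proof.
move=> ef eg; have eA : A = A' := congr1 (@arr_dom _ _) ef.
have eB : B = B' := congr1 (@arr_cod _ _) ef.
have eC : C = C' := congr1 (@arr_dom _ _) eg.
have eD : D = D' := congr1 (@arr_cod _ _) eg.
case: A' / eA f' ef => f' ef; case: B' / eB f' ef => f' ef.
case: C' / eC g' eg => g' eg; case: D' / eD g' eg => g' eg.
by rewrite (arr_inj ef) (arr_inj eg).
Qed.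

End ArrowLemmas.

Section Optics.
Variable (A : strict_moncat).

(* ⟨α | β⟩_M : (P.1, P.2) -> (Q.1, Q.2) *)
Record preoptic (P Q : A * A) := PreOptic {
  residual : A;
  fwd : hom P.1 (residual ⊗ Q.1);
  bwd : hom (residual ⊗ Q.2) P.2 }.
Arguments PreOptic {P Q} residual fwd bwd.

Inductive slide (P Q : A * A) : relation (preoptic P Q) :=
| Slide (M N : A) (f : hom M N)
    (a : hom P.1 (M ⊗ Q.1)) (b : hom (N ⊗ Q.2) P.2) :
    slide (PreOptic N (a ;; f ⊗₁ idm Q.1) b)
          (PreOptic M a (f ⊗₁ idm Q.2 ;; b)).

Definition optic (P Q : A * A) : Type := quotient (@slide P Q).

Definition preoptic_id (P : A * A) : preoptic P P :=
  PreOptic unit_ob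
    (cast erefl (esym (ten_unitl P.1)) (idm P.1))
    (cast (esym (ten_unitl P.2)) erefl (idm P.2)).

Definition preoptic_comp (P Q R : A * A) (x : preoptic P Q) (y : preoptic Q R) :
    preoptic P R :=
  let M := residual x in
  let N := residual y in
  PreOptic (M ⊗ N)
    (cast erefl (esym (ten_assoc M N R.1)) (fwd x ;; idm M ⊗₁ fwd y))
    (cast (esym (ten_assoc M N R.2)) erefl (idm M ⊗₁ bwd y ;; bwd x)).

Definition optic_id (P : A * A) : optic P P := cls _ (preoptic_id P).

Definition optic_comp (P Q R : A * A) (x : optic P Q) (y : optic Q R) :
    optic P R :=
  cls _ (preoptic_comp (rep x) (rep y)).

Lemma preoptic_eq (P Q : A * A) (M M' : A)
    (a : hom P.1 (M ⊗ Q.1)) (b : hom (M ⊗ Q.2) P.2)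
    (a' : hom P.1 (M' ⊗ Q.1)) (b' : hom (M' ⊗ Q.2) P.2) :
  M = M' -> Arr a = Arr a' -> Arr b = Arr b' ->
  PreOptic M a b = PreOptic M' a' b'.
Proof.
move=> e; case: M' / e a' b' => a' b' ea eb.
by rewrite (arr_inj ea) (arr_inj eb).
Qed.

Lemma preoptic_comp_slidel (P Q R : A * A) (x x' : preoptic P Q)
    (y : preoptic Q R) :
  slide x x' -> slide (preoptic_comp x y) (preoptic_comp x' y).
Proof.
case=> M N f a b; case: y => K c d; rewrite /preoptic_comp /=.
set a1 := cast _ _ (a ;; _).
set b1 := cast _ _ (_ ;; b).
have := @Slide P R (M ⊗ K) (N ⊗ K) (f ⊗₁ idm K) a1 b1.
congr (slide _ _); apply: preoptic_eq => //.
- rewrite arr_cast.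
  transitivity (Arr ((a ;; idm M ⊗₁ c) ;; f ⊗₁ (idm K ⊗₁ idm R.1))).
    apply: arr_comp; first by rewrite arr_cast.
    by rewrite htens_assoc.
  rewrite !comp_assoc htens_id -!htens_comp.
  by rewrite !comp_idl !comp_idr.
- rewrite arr_cast.
  transitivity (Arr (f ⊗₁ (idm K ⊗₁ idm R.2) ;; (idm N ⊗₁ d ;; b))).
    apply: arr_comp; last by rewrite arr_cast.
    by rewrite htens_assoc.
  rewrite -!comp_assoc htens_id -!htens_comp.
  by rewrite !comp_idl !comp_idr.
Qed.

Lemma preoptic_comp_slider (P Q R : A * A) (x : preoptic P Q)
    (y y' : preoptic Q R) :
  slide y y' -> slide (preoptic_comp x y) (preoptic_comp x y').
Proof.
case=> M N f c d; case: x => K a b; rewrite /preoptic_comp /=.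
set a1 := cast _ _ (a ;; idm K ⊗₁ c).
set b1 := cast _ _ (idm K ⊗₁ d ;; b).
have := @Slide P R (K ⊗ M) (K ⊗ N) (idm K ⊗₁ f) a1 b1.
congr (slide _ _); apply: preoptic_eq => //.
- rewrite arr_cast.
  transitivity (Arr ((a ;; idm K ⊗₁ c) ;; idm K ⊗₁ (f ⊗₁ idm R.1))).
    by apply: arr_comp; rewrite ?arr_cast ?htens_assoc.
  by rewrite !comp_assoc -!htens_comp !comp_idl.
- rewrite arr_cast.
  transitivity (Arr (idm K ⊗₁ (f ⊗₁ idm R.2) ;; (idm K ⊗₁ d ;; b))).
    by apply: arr_comp; rewrite ?arr_cast ?htens_assoc.
  by rewrite -!comp_assoc -!htens_comp !comp_idl.
Qed.

Lemma optic_comp_cls (P Q R : A * A) (x : preoptic P Q) (y : preoptic Q R) :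
  optic_comp (cls _ x) (cls _ y) = cls _ (preoptic_comp x y).
Proof.
apply/clsP; apply: (@rst_trans _ _ _ (preoptic_comp x (rep (cls _ y)))).
  apply: (rst_map (f := fun u => preoptic_comp u _)); last exact: rep_cls.
  by move=> u v; apply: preoptic_comp_slidel.
apply: (rst_map (f := preoptic_comp x)); last exact: rep_cls.
by move=> u v; apply: preoptic_comp_slider.
Qed.

Lemma optic_comp_assoc (P Q R S : A * A)
    (x : optic P Q) (y : optic Q R) (z : optic R S) :
  optic_comp (optic_comp x y) z = optic_comp x (optic_comp y z).
Proof.
rewrite -[x]repK -[y]repK -[z]repK !optic_comp_cls; congr cls.
case: (rep x) (rep y) (rep z) => [M a b] [N c d] [K e f].
rewrite /preoptic_comp /=; apply: preoptic_eq; first exact: ten_assoc.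
- rewrite !arr_cast.
  transitivity (Arr ((a ;; idm M ⊗₁ c) ;; idm M ⊗₁ (idm N ⊗₁ e))).
    apply: arr_comp; rewrite ?arr_cast //.
    by rewrite -htens_id htens_assoc.
  rewrite comp_assoc; apply: arr_comp => //.
  rewrite -htens_comp comp_idl; apply: arr_htens => //.
  by rewrite arr_cast.
- rewrite !arr_cast.
  transitivity (Arr (idm M ⊗₁ (idm N ⊗₁ f) ;; (idm M ⊗₁ d ;; b))).
    apply: arr_comp; rewrite ?arr_cast //.
    by rewrite -htens_id htens_assoc.
  rewrite -comp_assoc; apply: arr_comp => //.
  rewrite -htens_comp comp_idl; apply: arr_htens => //.
  by rewrite arr_cast.
Qed.

Lemma optic_comp_idl (P Q : A * A) (x : optic P Q) :
  optic_comp (optic_id P) x = x.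
Proof.
rewrite -[x]repK optic_comp_cls; congr cls; case: (rep x) => [M a b].
rewrite /preoptic_comp /=; apply: preoptic_eq; first exact: ten_unitl.
- rewrite arr_cast; transitivity (Arr (idm P.1 ;; a)); last by rewrite comp_idl.
  by apply: arr_comp; rewrite ?arr_cast ?htens_unitl.
- rewrite arr_cast; transitivity (Arr (b ;; idm P.2)); last by rewrite comp_idr.
  by apply: arr_comp; rewrite ?arr_cast ?htens_unitl.
Qed.

Lemma optic_comp_idr (P Q : A * A) (x : optic P Q) :
  optic_comp x (optic_id Q) = x.
Proof.
rewrite -[x]repK optic_comp_cls; congr cls; case: (rep x) => [M a b].
rewrite /preoptic_comp /=; apply: preoptic_eq; first exact: ten_unitr.
- rewrite arr_cast; transitivity (Arr (a ;; idm (M ⊗ Q.1)));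
    last by rewrite comp_idr.
  apply: arr_comp => //; rewrite -htens_id.
  by apply: arr_htens; rewrite ?arr_cast.
- rewrite arr_cast; transitivity (Arr (idm (M ⊗ Q.2) ;; b));
    last by rewrite comp_idl.
  apply: arr_comp => //; rewrite -htens_id.
  by apply: arr_htens; rewrite ?arr_cast.
Qed.

Definition Optic : category :=
  @Category (A * A)%type optic optic_id optic_comp
    optic_comp_assoc optic_comp_idl optic_comp_idr.

End Optics.

(* The library's [monoidType] requires a choiceType carrier, which the objects
   of a category need not have. *)
Record monoid := Monoid {
  mon_sort :> Type;
  mop : mon_sort -> mon_sort -> mon_sort;
  munit : mon_sort;
  mopA : forall x y z, mop (mop x y) z = mop x (mop y z);
  mop1l : forall x, mop munit x = x;
  mop1r : forall x, mop x munit = x }.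

Arguments mop {m} _ _.
Arguments munit {m}.

Definition ob_monoid (A : strict_moncat) : monoid :=
  @Monoid A ten unit_ob (@ten_assoc A) (@ten_unitl A) (@ten_unitr A).

Definition free_monoid (T : Type) : monoid :=
  @Monoid (seq T) cat [::] (fun x y z => esym (catA x y z)) (@cat0s T) (@cats0 T).

(* The total set of cells, with boundaries listed as left, top, bottom, right.
   As for [arrow], equations between cells whose boundaries are only
   propositionally equal are stated in this set. *)
Record square (V H : Type) (C : V -> H -> H -> V -> Type) := Sq {
  sq_left : V; sq_top : H; sq_bot : H; sq_right : V;
  sq_cell : C sq_left sq_top sq_bot sq_right }.
Arguments Sq {V H C sq_left sq_top sq_bot sq_right} _.

(* The single object is left implicit: edges are the elements of the two
   monoids.  In [cell X A B Y], [X] is the left, [A] the top, [B] the bottom and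
   [Y] the right boundary. *)
Record sodcat := SODCat {
  hedge : monoid;
  vedge : monoid;
  cell : vedge -> hedge -> hedge -> vedge -> Type;
  hcomp : forall X Y Z A B A' B',
    cell X A B Y -> cell Y A' B' Z -> cell X (mop A A') (mop B B') Z;
  vcomp : forall X X' Y Y' A B C,
    cell X A B Y -> cell X' B C Y' -> cell (mop X X') A C (mop Y Y');
  hid : forall X, cell X munit munit X;
  vid : forall A, cell munit A A munit;
  hcompA : forall X Y Z W A B A' B' A'' B''
      (a : cell X A B Y) (b : cell Y A' B' Z) (c : cell Z A'' B'' W),
    Sq (hcomp (hcomp a b) c) = Sq (hcomp a (hcomp b c));
  hcomp_idl : forall X Y A B (a : cell X A B Y), Sq (hcomp (hid X) a) = Sq a;
  hcomp_idr : forall X Y A B (a : cell X A B Y), Sq (hcomp a (hid Y)) = Sq a;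
  vcompA : forall X X' X'' Y Y' Y'' A B C D
      (a : cell X A B Y) (b : cell X' B C Y') (c : cell X'' C D Y''),
    Sq (vcomp (vcomp a b) c) = Sq (vcomp a (vcomp b c));
  vcomp_idl : forall X Y A B (a : cell X A B Y), Sq (vcomp (vid A) a) = Sq a;
  vcomp_idr : forall X Y A B (a : cell X A B Y), Sq (vcomp a (vid B)) = Sq a;
  hid_mop : forall X Y, Sq (hid (mop X Y)) = Sq (vcomp (hid X) (hid Y));
  vid_mop : forall A B, Sq (vid (mop A B)) = Sq (hcomp (vid A) (vid B));
  hid_unit : Sq (hid munit) = Sq (vid munit);
  interchange : forall X X' Y Y' Z Z' A B C A' B' C'
      (a : cell X A B Y) (b : cell X' B C Y')
      (c : cell Y A' B' Z) (d : cell Y' B' C' Z'),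
    hcomp (vcomp a b) (vcomp c d) = vcomp (hcomp a c) (hcomp b d) }.

Arguments cell {s} _ _ _ _.
Arguments hcomp {s X Y Z A B A' B'} _ _.
Arguments vcomp {s X X' Y Y' A B C} _ _.
Arguments hid {s} X.
Arguments vid {s} A.

Section SquareLemmas.

Definition sq_cast (V H : Type) (C : V -> H -> H -> V -> Type)
    (X X' : V) (A A' B B' : H) (Y Y' : V)
    (eX : X = X') (eA : A = A') (eB : B = B') (eY : Y = Y')
    (a : C X A B Y) : C X' A' B' Y' :=
  let: erefl := eX in let: erefl := eA in
  let: erefl := eB in let: erefl := eY in a.
Arguments sq_cast : simpl never.

Lemma Sq_inj (V H : Type) (C : V -> H -> H -> V -> Type) X A B Y
  (a b : C X A B Y) : Sq a = Sq b -> a = b.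
Proof.
have gen (x y : square C) (exy : x = y) (e1 : sq_left x = sq_left y)
    (e2 : sq_top x = sq_top y) (e3 : sq_bot x = sq_bot y)
    (e4 : sq_right x = sq_right y) :
    sq_cast e1 e2 e3 e4 (sq_cell x) = sq_cell y.
  case: y / exy e1 e2 e3 e4 => e1 e2 e3 e4.
  rewrite (Prop_irrelevance e1 erefl) (Prop_irrelevance e2 erefl).
  by rewrite (Prop_irrelevance e3 erefl) (Prop_irrelevance e4 erefl).
by move=> e; apply: (gen _ _ e erefl erefl erefl erefl).
Qed.

Lemma Sq_cast (V H : Type) (C : V -> H -> H -> V -> Type) X X' A A' B B' Y Y'
  (eX : X = X') (eA : A = A') (eB : B = B') (eY : Y = Y') (a : C X A B Y) :
  Sq (sq_cast eX eA eB eY a) = Sq a.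
Proof. by case: X' / eX; case: A' / eA; case: B' / eB; case: Y' / eY. Qed.

Lemma Sq_hcomp (D : sodcat) (X Y Z X1 Y1 Z1 : vedge D)
    (A B A' B' A1 B1 A1' B1' : hedge D)
    (a : cell X A B Y) (b : cell Y A' B' Z)
    (a1 : cell X1 A1 B1 Y1) (b1 : cell Y1 A1' B1' Z1) :
  Sq a = Sq a1 -> Sq b = Sq b1 -> Sq (hcomp a b) = Sq (hcomp a1 b1).
Proof.
move=> ea eb.
have e1 : X = X1 := congr1 (@sq_left _ _ _) ea.
have e2 : A = A1 := congr1 (@sq_top _ _ _) ea.
have e3 : B = B1 := congr1 (@sq_bot _ _ _) ea.
have e4 : Y = Y1 := congr1 (@sq_right _ _ _) ea.
have e5 : A' = A1' := congr1 (@sq_top _ _ _) eb.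
have e6 : B' = B1' := congr1 (@sq_bot _ _ _) eb.
have e7 : Z = Z1 := congr1 (@sq_right _ _ _) eb.
subst X1 A1 B1 Y1 A1' B1' Z1.
by rewrite (Sq_inj ea) (Sq_inj eb).
Qed.

End SquareLemmas.

Section HorizontalCells.
Variable D : sodcat.

Definition hcell (X Y : vedge D) : Type := cell X munit munit Y.

Definition hcell_comp (X Y Z : vedge D) (a : hcell X Y) (b : hcell Y Z) :
    hcell X Z :=
  sq_cast erefl (mop1l munit) (mop1l munit) erefl (hcomp a b).

Lemma hcell_compA (X Y Z W : vedge D)
    (a : hcell X Y) (b : hcell Y Z) (c : hcell Z W) :
  hcell_comp (hcell_comp a b) c = hcell_comp a (hcell_comp b c).
Proof.
apply: Sq_inj; rewrite !Sq_cast.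
transitivity (Sq (hcomp (hcomp a b) c)); first by apply: Sq_hcomp; rewrite ?Sq_cast.
by rewrite hcompA; apply: Sq_hcomp; rewrite ?Sq_cast.
Qed.

Lemma hcell_comp_idl (X Y : vedge D) (a : hcell X Y) : hcell_comp (hid X) a = a.
Proof. by apply: Sq_inj; rewrite Sq_cast hcomp_idl. Qed.

Lemma hcell_comp_idr (X Y : vedge D) (a : hcell X Y) : hcell_comp a (hid Y) = a.
Proof. by apply: Sq_inj; rewrite Sq_cast hcomp_idr. Qed.

Definition Hcat : category :=
  @Category (vedge D) hcell hid hcell_comp
    hcell_compA hcell_comp_idl hcell_comp_idr.

End HorizontalCells.

Inductive polarity := circ | bullet.

Section FreeCornering.
Variable A : strict_moncat.

Let H : monoid := ob_monoid A.
Let V : monoid := free_monoid (A * polarity).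

Definition port (P : A) (p : polarity) : V := [:: (P, p)].
Local Notation "P °" := (port P circ) (at level 1, format "P °").
Local Notation "P •" := (port P bullet) (at level 1, format "P •").

(* [TsendC], [TrecvC], [TrecvB], [TsendB] are the corners s°, r°, r•, s•. *)
Inductive term : V -> H -> H -> V -> Type :=
| Thcomp X Y Z P Q P' Q' :
    term X P Q Y -> term Y P' Q' Z -> term X (mop P P') (mop Q Q') Z
| Tvcomp X X' Y Y' P Q R :
    term X P Q Y -> term X' Q R Y' -> term (mop X X') P R (mop Y Y')
| Thid X : term X munit munit X
| Tvid P : term munit P P munit
| Tgen (P Q : A) (f : hom P Q) : term munit P Q munit
| TsendC P : term munit P munit P°
| TrecvC P : term P° munit P munit
| TrecvB P : term munit munit P P•
| TsendB P : term P• P munit munit.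

(* The relation lives on the total set of terms because the two sides of an
   axiom may have boundaries that are only propositionally equal; related terms
   have equal boundaries ([ceq_boundary]). *)
Inductive ceq : square term -> square term -> Prop :=
| ceq_refl x : ceq x x
| ceq_sym x y : ceq x y -> ceq y x
| ceq_trans x y z : ceq x y -> ceq y z -> ceq x z
| ceq_hcomp X Y Z P Q P' Q' X1 Y1 Z1 P1 Q1 P1' Q1'
    (a : term X P Q Y) (b : term Y P' Q' Z)
    (a1 : term X1 P1 Q1 Y1) (b1 : term Y1 P1' Q1' Z1) :
    ceq (Sq a) (Sq a1) -> ceq (Sq b) (Sq b1) ->
    ceq (Sq (Thcomp a b)) (Sq (Thcomp a1 b1))
| ceq_vcomp X X' Y Y' P Q R X1 X1' Y1 Y1' P1 Q1 R1
    (a : term X P Q Y) (b : term X' Q R Y')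
    (a1 : term X1 P1 Q1 Y1) (b1 : term X1' Q1 R1 Y1') :
    ceq (Sq a) (Sq a1) -> ceq (Sq b) (Sq b1) ->
    ceq (Sq (Tvcomp a b)) (Sq (Tvcomp a1 b1))
| ceq_hcompA X Y Z W P Q P' Q' P'' Q''
    (a : term X P Q Y) (b : term Y P' Q' Z) (c : term Z P'' Q'' W) :
    ceq (Sq (Thcomp (Thcomp a b) c)) (Sq (Thcomp a (Thcomp b c)))
| ceq_hcomp_idl X Y P Q (a : term X P Q Y) :
    ceq (Sq (Thcomp (Thid X) a)) (Sq a)
| ceq_hcomp_idr X Y P Q (a : term X P Q Y) :
    ceq (Sq (Thcomp a (Thid Y))) (Sq a)
| ceq_vcompA X X' X'' Y Y' Y'' P Q R S
    (a : term X P Q Y) (b : term X' Q R Y') (c : term X'' R S Y'') :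
    ceq (Sq (Tvcomp (Tvcomp a b) c)) (Sq (Tvcomp a (Tvcomp b c)))
| ceq_vcomp_idl X Y P Q (a : term X P Q Y) :
    ceq (Sq (Tvcomp (Tvid P) a)) (Sq a)
| ceq_vcomp_idr X Y P Q (a : term X P Q Y) :
    ceq (Sq (Tvcomp a (Tvid Q))) (Sq a)
| ceq_hid_mop X Y : ceq (Sq (Thid (mop X Y))) (Sq (Tvcomp (Thid X) (Thid Y)))
| ceq_vid_mop P Q : ceq (Sq (Tvid (mop P Q))) (Sq (Thcomp (Tvid P) (Tvid Q)))
| ceq_hid_unit : ceq (Sq (Thid munit)) (Sq (Tvid munit))
| ceq_interchange X X' Y Y' Z Z' P Q R P' Q' R'
    (a : term X P Q Y) (b : term X' Q R Y')
    (c : term Y P' Q' Z) (d : term Y' Q' R' Z') :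
    ceq (Sq (Thcomp (Tvcomp a b) (Tvcomp c d)))
        (Sq (Tvcomp (Thcomp a c) (Thcomp b d)))
| ceq_gen_comp (P Q R : A) (f : hom P Q) (g : hom Q R) :
    ceq (Sq (Tgen (f ;; g))) (Sq (Tvcomp (Tgen f) (Tgen g)))
| ceq_gen_id (P : A) : ceq (Sq (Tgen (idm P))) (Sq (Tvid P))
| ceq_gen_htens (P Q R S : A) (f : hom P Q) (g : hom R S) :
    ceq (Sq (Tgen (f ⊗₁ g))) (Sq (Thcomp (Tgen f) (Tgen g)))
| ceq_yankCh P : ceq (Sq (Thcomp (TsendC P) (TrecvC P))) (Sq (Tvid P))
| ceq_yankCv P : ceq (Sq (Tvcomp (TrecvC P) (TsendC P))) (Sq (Thid P°))
| ceq_yankBh P : ceq (Sq (Thcomp (TrecvB P) (TsendB P))) (Sq (Tvid P))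
| ceq_yankBv P : ceq (Sq (Tvcomp (TrecvB P) (TsendB P))) (Sq (Thid P•)).

Lemma ceq_boundary x y : ceq x y ->
  [/\ sq_left x = sq_left y, sq_top x = sq_top y,
      sq_bot x = sq_bot y & sq_right x = sq_right y].
Proof.
elim=> {x y} //=.
- by move=> x y _ [].
- by move=> x y z _ [-> -> -> ->] _ [-> -> -> ->].
- move=> X Y Z P Q P' Q' X1 Y1 Z1 P1 Q1 P1' Q1' a b a1 b1.
  by move=> _ ea _ [_ -> -> ->]; case: ea => -> -> -> _.
- move=> X X' Y Y' P Q R X1 X1' Y1 Y1' P1 Q1 R1 a b a1 b1.
  by move=> _ ea _ [-> _ -> ->]; case: ea => -> -> _ ->.
- by move=> *; split=> //; apply: (mopA (m := H)).
- by move=> *; split=> //; apply: (mop1l (m := H)).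
- by move=> *; split=> //; apply: (mop1r (m := H)).
- by move=> *; split=> //; apply: (mopA (m := V)).
- by move=> *; split=> //; apply: (mop1r (m := V)).
- by move=> P; split=> //; [apply: (mop1r (m := H)) | apply: (mop1l (m := H))].
- by move=> P; split=> //; [apply: (mop1l (m := H)) | apply: (mop1r (m := H))].
Qed.

Definition term_eq X P Q Y : relation (term X P Q Y) :=
  fun a b => ceq (Sq a) (Sq b).

Definition fc_cell X P Q Y : Type := quotient (@term_eq X P Q Y).

Definition fc_hcomp X Y Z P Q P' Q'
    (a : fc_cell X P Q Y) (b : fc_cell Y P' Q' Z) :
    fc_cell X (mop P P') (mop Q Q') Z :=
  cls _ (Thcomp (rep a) (rep b)).

Definition fc_vcomp X X' Y Y' P Q R
    (a : fc_cell X P Q Y) (b : fc_cell X' Q R Y') :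
    fc_cell (mop X X') P R (mop Y Y') :=
  cls _ (Tvcomp (rep a) (rep b)).

Definition fc_hid X : fc_cell X munit munit X := cls _ (Thid X).
Definition fc_vid P : fc_cell munit P P munit := cls _ (Tvid P).

Lemma fc_clsP X P Q Y (a b : term X P Q Y) :
  cls (@term_eq X P Q Y) a = cls _ b <-> ceq (Sq a) (Sq b).
Proof.
rewrite clsP; split=> [|ab]; last exact: rst_step.
elim=> //.
- by move=> u; apply: ceq_refl.
- by move=> u v _; apply: ceq_sym.
- by move=> u v w _ uv _; apply: ceq_trans uv.
Qed.

Lemma Sq_cls X P Q Y X1 P1 Q1 Y1 (a : term X P Q Y) (b : term X1 P1 Q1 Y1) :
  ceq (Sq a) (Sq b) ->
  Sq (cls (@term_eq X P Q Y) a : fc_cell X P Q Y)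
  = Sq (cls (@term_eq X1 P1 Q1 Y1) b : fc_cell X1 P1 Q1 Y1).
Proof.
move=> ab; have [/= e1 e2 e3 e4] := ceq_boundary ab; subst X1 P1 Q1 Y1.
by congr Sq; apply/fc_clsP.
Qed.

Lemma ceq_rep X P Q Y (a : term X P Q Y) :
  ceq (Sq (rep (cls (@term_eq X P Q Y) a))) (Sq a).
Proof. by apply/fc_clsP; rewrite repK. Qed.

Lemma fc_hcomp_cls X Y Z P Q P' Q' (a : term X P Q Y) (b : term Y P' Q' Z) :
  fc_hcomp (cls _ a) (cls _ b) = cls _ (Thcomp a b).
Proof. by apply/fc_clsP; apply: ceq_hcomp; apply: ceq_rep. Qed.

Lemma fc_vcomp_cls X X' Y Y' P Q R (a : term X P Q Y) (b : term X' Q R Y') :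
  fc_vcomp (cls _ a) (cls _ b) = cls _ (Tvcomp a b).
Proof. by apply/fc_clsP; apply: ceq_vcomp; apply: ceq_rep. Qed.

Definition free_cornering : sodcat.
Proof.
refine (@SODCat H V fc_cell fc_hcomp fc_vcomp fc_hid fc_vid
  _ _ _ _ _ _ _ _ _ _).
- move=> X Y Z W P Q P' Q' P'' Q'' a b c.
  rewrite -[a]repK -[b]repK -[c]repK !fc_hcomp_cls.
  by apply: Sq_cls; apply: ceq_hcompA.
- move=> X Y P Q a; rewrite -[a]repK fc_hcomp_cls.
  by apply: Sq_cls; apply: ceq_hcomp_idl.
- move=> X Y P Q a; rewrite -[a]repK fc_hcomp_cls.
  by apply: Sq_cls; apply: ceq_hcomp_idr.
- move=> X X' X'' Y Y' Y'' P Q R S a b c.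
  rewrite -[a]repK -[b]repK -[c]repK !fc_vcomp_cls.
  by apply: Sq_cls; apply: ceq_vcompA.
- move=> X Y P Q a; rewrite -[a]repK fc_vcomp_cls.
  by apply: Sq_cls; apply: ceq_vcomp_idl.
- move=> X Y P Q a; rewrite -[a]repK fc_vcomp_cls.
  by apply: Sq_cls; apply: ceq_vcomp_idr.
- by move=> X Y; rewrite fc_vcomp_cls; apply: Sq_cls; apply: ceq_hid_mop.
- by move=> P Q; rewrite fc_hcomp_cls; apply: Sq_cls; apply: ceq_vid_mop.
- by apply: Sq_cls; apply: ceq_hid_unit.
- move=> X X' Y Y' Z Z' P Q R P' Q' R' a b c d.
  rewrite -[a]repK -[b]repK -[c]repK -[d]repK.
  rewrite !(fc_hcomp_cls, fc_vcomp_cls).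
  by apply/fc_clsP; apply: ceq_interchange.
Defined.

Definition optic_boundary (P Q : A) : Hcat free_cornering :=
  mop (m := V) P° Q•.

Definition optic_subcategory : category :=
  @full_subcategory (Hcat free_cornering)
    (fun X => exists P Q : A, X = optic_boundary P Q).

End FreeCornering.

Notation "P °" := (port P circ) (at level 1, format "P °") : cat_scope.
Notation "P •" := (port P bullet) (at level 1, format "P •") : cat_scope.

(* Main.v *)
From Stdlib Require Import Relations.
From mathcomp Require Import all_boot boolp.
Require Import Defs.

(** The optic ⟨α | β⟩_M from (A, B) to (C, D) is sent to the cell obtained by
    stacking r°_A, α, 1_M | s°_C, 1_M | r•_D, β and s•_B: receive A on the left,
    run α, send C on the right, receive D from the right, run β, send B on the
    left.  The corners r°_A and s•_B only bend wires: by the yanking equations,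
    cells from A° ⊗ B• to Y with trivial top and bottom correspond to cells with
    trivial left boundary, top A, bottom B and right boundary Y ([bent_bend],
    [bend_hc]).  So it has to be shown that the cells with trivial left boundary,
    top A, bottom B and right boundary C° ⊗ D• are exactly the optics.

    Every cell has such a form.  A cell with trivial left boundary is in normal
    form ([nf]) if it is a stack of arrows of the category alternating with the
    cells 1_M | s°_P and 1_M | r•_P.  Pasting an arbitrary cell on the right of a
    normal form yields a normal form ([nf_act]); this goes by induction on the
    term denoting the cell, the yanking equations being what absorbs the corners
    r° and s•.  Pasting a given cell from A° ⊗ B• to the normal form of s°_A over
    r•_B therefore displays it as an optic ([ocell_surj]).

    Distinct optics give distinct cells.  This needs an invariant of cells, which
    is a model of the free cornering in profunctors from the category to itself:
    P° is interpreted by Hom(-, - ⊗ P), P• by Hom(- ⊗ P, -), a word of ports by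
    the composite profunctor, and a cell X, P, Q, Y by a natural family of maps
    from X(a, b) to Y(a ⊗ P, b ⊗ Q).  An element of the composite for a word X is
    a list of arrows interleaved with the ports ([comb]), up to sliding arrows
    along the ports ([comb_eq]), which is the coend computing the composite.
    Terms act on such lists ([act]), and the action respects the equations of the
    free cornering ([act_sound]).  Letting the unbent cell of ⟨α | β⟩_M act on
    the identity of the unit object gives the list α, 1_M, β ([sact_ocell]), and
    for the word C° ⊗ D• sliding is precisely the relation defining optics
    ([ocell_inj]).

    The laws of a strict monoidal category and of a double category relate
    things whose boundaries are equal but not convertible.  To calculate without
    transports, arrows and squares are composed below by total operations on the
    sets of all arrows and of all squares, and the action is defined on lists of
    arrows of arbitrary types, well-typedness being a separate predicate. *)

Set Implicit Arguments.
Unset Strict Implicit.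
Unset Printing Implicit Defensive.

(** * Isomorphisms of categories *)

Lemma functor_eq (C D : category) (G G' : functor C D) :
  (forall X, G X = G' X) ->
  (forall X Y (f : hom X Y), Arr (fmap G f) = Arr (fmap G' f)) -> G = G'.
Proof.
case: G G' => [o m i c] [o' m' i' c'] /= eo em.
have {}eo : o = o' by apply: funext.
subst o'; have {}em : m = m'.
  apply: functional_extensionality_dep => X; apply: functional_extensionality_dep => Y.
  by apply: funext => f; apply: arr_inj (em X Y f).
by subst m'; congr Functor; apply: Prop_irrelevance.
Qed.

(** Strict isomorphism is an equality of functors, hence the inverse must be
    built on arrows between objects that are only provably in the image; [gmE]
    pins down its values in the set of all arrows, where no transport shows. *)
Lemma bijective_cat_iso (C D : category) (F : functor C D) (g : D -> C) :
  cancel F g -> cancel g F ->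
  (forall X Y (f f' : hom X Y), fmap F f = fmap F f' -> f = f') ->
  (forall X Y (h : hom (F X) (F Y)), exists f, fmap F f = h) ->
  is_cat_iso F.
Proof.
move=> FK gK inj surj.
have ex (X Y : D) (h : hom X Y) : {f : hom (g X) (g Y) | Arr (fmap F f) = Arr h}.
  apply: cid.
  (* surjectivity applies to arrows between values of F only *)
  have [f Ef] := surj _ _ (cast (esym (gK X)) (esym (gK Y)) h).
  by exists f; rewrite Ef arr_cast.
have inj' X Y X' Y' (f : hom X Y) (f' : hom X' Y') :
    Arr (fmap F f) = Arr (fmap F f') -> Arr f = Arr f'.
  move=> ef; have eX : X = X' := can_inj FK (congr1 (@arr_dom _ _) ef).
  have eY : Y = Y' := can_inj FK (congr1 (@arr_cod _ _) ef).
  by subst X' Y'; rewrite (inj _ _ _ _ (arr_inj ef)).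
pose gm X Y (h : hom X Y) := sval (ex X Y h).
have gmE X Y (h : hom X Y) : Arr (fmap F (gm X Y h)) = Arr h := svalP (ex X Y h).
have gid X : gm X X (idm X) = idm (g X).
  by apply: inj; apply: arr_inj; rewrite gmE fmap_id gK.
have gcomp X Y Z (h : hom X Y) (k : hom Y Z) :
    gm X Z (h ;; k) = gm X Y h ;; gm Y Z k.
  apply: inj; apply: arr_inj; rewrite gmE fmap_comp.
  by apply: esym; apply: arr_comp; apply: gmE.
exists (Functor gid gcomp); split; apply: functor_eq => //= X Y f.
by apply: inj'; rewrite gmE.
Qed.

(** * Composing squares with unspecified boundaries *)

Section Squares.
Variable D : sodcat.
Local Notation sqr := (square (@cell D)).

(** The value is junk when the boundaries do not match.  Totality makes composites
    of squares ordinary terms, in which equations can be rewritten; the typing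
    conditions are supplied by [bd]. *)
Definition hc (x y : sqr) : sqr :=
  if pselect (sq_left y = sq_right x) is left e
  then Sq (hcomp (sq_cell x) (sq_cast e erefl erefl erefl (sq_cell y))) else x.

Definition vc (x y : sqr) : sqr :=
  if pselect (sq_top y = sq_bot x) is left e
  then Sq (vcomp (sq_cell x) (sq_cast erefl e erefl erefl (sq_cell y))) else x.

Lemma hcE X Y Z P Q P' Q' (a : @cell D X P Q Y) (b : cell Y P' Q' Z) :
  hc (Sq a) (Sq b) = Sq (hcomp a b).
Proof.
by rewrite /hc; case: pselect => //= e; rewrite (Prop_irrelevance e erefl).
Qed.

Lemma vcE X X' Y Y' P Q R (a : @cell D X P Q Y) (b : cell X' Q R Y') :
  vc (Sq a) (Sq b) = Sq (vcomp a b).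
Proof.
by rewrite /vc; case: pselect => //= e; rewrite (Prop_irrelevance e erefl).
Qed.

Definition bd (x : sqr) X P Q Y : Prop := exists c : cell X P Q Y, x = Sq c.

Lemma bd_hc x y X P Q Y P' Q' Z :
  bd x X P Q Y -> bd y Y P' Q' Z -> bd (hc x y) X (mop P P') (mop Q Q') Z.
Proof. by move=> [a ->] [b ->]; rewrite hcE; exists (hcomp a b). Qed.

Lemma bd_vc x y X P Q Y X' R Y' :
  bd x X P Q Y -> bd y X' Q R Y' -> bd (vc x y) (mop X X') P R (mop Y Y').
Proof. by move=> [a ->] [b ->]; rewrite vcE; exists (vcomp a b). Qed.

Lemma bd_hid X : bd (Sq (hid X)) X munit munit X.
Proof. by exists (hid X). Qed.

Lemma hcA x y z X P Q Y P' Q' Z P'' Q'' W :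
  bd x X P Q Y -> bd y Y P' Q' Z -> bd z Z P'' Q'' W ->
  hc (hc x y) z = hc x (hc y z).
Proof. by move=> [a ->] [b ->] [c ->]; rewrite !hcE hcompA. Qed.

Lemma vcA x y z X P Q Y X' R Y' X'' S Y'' :
  bd x X P Q Y -> bd y X' Q R Y' -> bd z X'' R S Y'' ->
  vc (vc x y) z = vc x (vc y z).
Proof. by move=> [a ->] [b ->] [c ->]; rewrite !vcE vcompA. Qed.

Lemma hc_idl x X P Q Y : bd x X P Q Y -> hc (Sq (hid X)) x = x.
Proof. by move=> [a ->]; rewrite hcE hcomp_idl. Qed.

Lemma hc_idr x X P Q Y : bd x X P Q Y -> hc x (Sq (hid Y)) = x.
Proof. by move=> [a ->]; rewrite hcE hcomp_idr. Qed.

Lemma vc_idl x X P Q Y : bd x X P Q Y -> vc (Sq (vid P)) x = x.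
Proof. by move=> [a ->]; rewrite vcE vcomp_idl. Qed.

Lemma vc_idr x X P Q Y : bd x X P Q Y -> vc x (Sq (vid Q)) = x.
Proof. by move=> [a ->]; rewrite vcE vcomp_idr. Qed.

Lemma hc_vc x x' y y' X X' Y Y' Z Z' P Q R P' Q' R' :
  bd x X P Q Y -> bd x' X' Q R Y' -> bd y Y P' Q' Z -> bd y' Y' Q' R' Z' ->
  hc (vc x x') (vc y y') = vc (hc x y) (hc x' y').
Proof.
by move=> [a ->] [b ->] [c ->] [d ->]; rewrite !(hcE, vcE) interchange.
Qed.

Lemma bd_cell x X P Q Y : bd x X P Q Y -> {c : cell X P Q Y | Sq c = x}.
Proof. by move=> /cid [c ->]; exists c. Qed.

End Squares.

(** * Generating cells of the free cornering *)

Section FreeCells.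
Variable A : strict_moncat.
Local Notation F := (free_cornering A).
Local Notation sqr := (square (@cell F)).
Local Notation bd := (@bd F).
Local Notation I := (@unit_ob A).

Definition tcell X P Q Y (t : term X P Q Y) : sqr :=
  @Sq _ _ (@cell F) X P Q Y (cls (@term_eq A X P Q Y) t).

Definition gen (P Q : A) (f : hom P Q) : sqr := tcell (Tgen f).
Definition sendC (P : A) : sqr := tcell (TsendC P).
Definition recvC (P : A) : sqr := tcell (TrecvC P).
Definition recvB (P : A) : sqr := tcell (TrecvB P).
Definition sendB (P : A) : sqr := tcell (TsendB P).

Lemma bd_tcell X P Q Y (t : term X P Q Y) : bd (tcell t) X P Q Y.
Proof. by exists (cls (@term_eq A X P Q Y) t). Qed.

Lemma bd_gen P Q (f : hom P Q) : bd (gen f) [::] P Q [::].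
Proof. exact: bd_tcell. Qed.
Lemma bd_sendC P : bd (sendC P) [::] P I P°.
Proof. exact: bd_tcell. Qed.
Lemma bd_recvC P : bd (recvC P) P° I P [::].
Proof. exact: bd_tcell. Qed.
Lemma bd_recvB P : bd (recvB P) [::] I P P•.
Proof. exact: bd_tcell. Qed.
Lemma bd_sendB P : bd (sendB P) P• P I [::].
Proof. exact: bd_tcell. Qed.

Lemma tcell_eq X P Q Y X1 P1 Q1 Y1 (t : term X P Q Y) (t1 : term X1 P1 Q1 Y1) :
  ceq (Sq t) (Sq t1) -> tcell t = tcell t1.
Proof. exact: Sq_cls. Qed.

Lemma tcell_hcomp X Y Z P Q P' Q' (t : term X P Q Y) (u : term Y P' Q' Z) :
  tcell (Thcomp t u) = hc (tcell t) (tcell u).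
Proof.
by rewrite /tcell hcE; congr Sq; apply: esym; apply: fc_hcomp_cls.
Qed.

Lemma tcell_vcomp X X' Y Y' P Q R (t : term X P Q Y) (u : term X' Q R Y') :
  tcell (Tvcomp t u) = vc (tcell t) (tcell u).
Proof.
by rewrite /tcell vcE; congr Sq; apply: esym; apply: fc_vcomp_cls.
Qed.

Lemma gen_comp P Q R (f : hom P Q) (g : hom Q R) :
  gen (f ;; g) = vc (gen f) (gen g).
Proof. by rewrite -tcell_vcomp; apply: tcell_eq; apply: ceq_gen_comp. Qed.

Lemma gen_id P : gen (idm P) = Sq (vid (P : hedge F)).
Proof. by apply: tcell_eq; apply: ceq_gen_id. Qed.

Lemma gen_ten P Q R S (f : hom P Q) (g : hom R S) :
  gen (f ⊗₁ g) = hc (gen f) (gen g).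
Proof. by rewrite -tcell_hcomp; apply: tcell_eq; apply: ceq_gen_htens. Qed.

Lemma gen_unit : gen (idm I) = Sq (hid (munit : vedge F)).
Proof. by rewrite gen_id; apply: esym; apply: hid_unit. Qed.

Lemma gen_Arr P Q P' Q' (f : hom P Q) (f' : hom P' Q') :
  Arr f = Arr f' -> gen f = gen f'.
Proof.
move=> ef; have eP : P = P' := congr1 (@arr_dom _ _) ef.
have eQ : Q = Q' := congr1 (@arr_cod _ _) ef.
by subst P' Q'; rewrite (arr_inj ef).
Qed.

Lemma yankCh P : hc (sendC P) (recvC P) = gen (idm P).
Proof. by rewrite -tcell_hcomp gen_id; apply: tcell_eq; apply: ceq_yankCh. Qed.
Lemma yankCv P : vc (recvC P) (sendC P) = Sq (hid (P° : vedge F)).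
Proof. by rewrite -tcell_vcomp; apply: tcell_eq; apply: ceq_yankCv. Qed.
Lemma yankBh P : hc (recvB P) (sendB P) = gen (idm P).
Proof. by rewrite -tcell_hcomp gen_id; apply: tcell_eq; apply: ceq_yankBh. Qed.
Lemma yankBv P : vc (recvB P) (sendB P) = Sq (hid (P• : vedge F)).
Proof. by rewrite -tcell_vcomp; apply: tcell_eq; apply: ceq_yankBv. Qed.

Lemma vc_genl x X P Q Y : bd x X P Q Y -> vc (gen (idm P)) x = x.
Proof. by rewrite gen_id; apply: vc_idl. Qed.
Lemma vc_genr x X P Q Y : bd x X P Q Y -> vc x (gen (idm Q)) = x.
Proof. by rewrite gen_id; apply: vc_idr. Qed.
Lemma hc_genl x P Q Y : bd x [::] P Q Y -> hc (gen (idm I)) x = x.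
Proof. by rewrite gen_unit; apply: hc_idl. Qed.
Lemma hc_genr x X P Q : bd x X P Q [::] -> hc x (gen (idm I)) = x.
Proof. by rewrite gen_unit; apply: hc_idr. Qed.

(** The corner s°_P with a wire M alongside.  The bottom boundary of this composite
    is M ⊗ I, which [bd_send] identifies with M. *)
Definition send (M P : A) : sqr := hc (gen (idm M)) (sendC P).
Definition recv (M P : A) : sqr := hc (gen (idm M)) (recvB P).

Lemma bd_send M P : bd (send M P) [::] (M ⊗ P) M P°.
Proof.
rewrite -[X in bd _ _ _ X _](ten_unitr M).
exact: bd_hc (bd_gen (idm M)) (bd_sendC P).
Qed.

Lemma bd_recv M P : bd (recv M P) [::] M (M ⊗ P) P•.
Proof.
rewrite -[X in bd _ _ X _ _](ten_unitr M).
exact: bd_hc (bd_gen (idm M)) (bd_recvB P).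
Qed.

(** Both ways of passing an arrow of the category through the port give the same
    square [hc (gen f) (sendC P)]: this common value is what turns the sliding
    relation of optics into an equation of cells. *)
Lemma gen_send M N P (f : hom M N) :
  vc (gen (f ⊗₁ idm P)) (send N P) = hc (gen f) (sendC P).
Proof.
rewrite gen_ten.
rewrite -(hc_vc (bd_gen f) (bd_gen (idm N)) (bd_gen (idm P)) (bd_sendC P)).
by rewrite (vc_genr (bd_gen f)) (vc_genl (bd_sendC P)).
Qed.

Lemma send_gen M N P (f : hom M N) :
  vc (send M P) (gen f) = hc (gen f) (sendC P).
Proof.
rewrite -[in LHS](hc_genr (bd_gen f)).
rewrite -(hc_vc (bd_gen (idm M)) (bd_gen f) (bd_sendC P) (bd_gen (idm I))).
by rewrite (vc_genl (bd_gen f)) (vc_genr (bd_sendC P)).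
Qed.

Lemma gen_recv M N P (f : hom M N) :
  vc (gen f) (recv N P) = hc (gen f) (recvB P).
Proof.
rewrite -[in LHS](hc_genr (bd_gen f)).
rewrite -(hc_vc (bd_gen f) (bd_gen (idm N)) (bd_gen (idm I)) (bd_recvB P)).
by rewrite (vc_genr (bd_gen f)) (vc_genl (bd_recvB P)).
Qed.

Lemma recv_gen M N P (f : hom M N) :
  vc (recv M P) (gen (f ⊗₁ idm P)) = hc (gen f) (recvB P).
Proof.
rewrite gen_ten.
rewrite -(hc_vc (bd_gen (idm M)) (bd_gen f) (bd_recvB P) (bd_gen (idm P))).
by rewrite (vc_genl (bd_gen f)) (vc_genr (bd_recvB P)).
Qed.

End FreeCells.

(** * Optics as cells *)

Section Bend.
Variable A : strict_moncat.
Local Notation F := (free_cornering A).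
Local Notation sqr := (square (@cell F)).
Local Notation bd := (@bd F).
Local Notation I := (@unit_ob A).

(** The cell whose pasting on the left bends the left boundary P.1° ⊗ P.2• up and
    down into the top and the bottom; [bend] is the inverse operation. *)
Definition bent (P : A * A) : sqr := vc (sendC P.1) (recvB P.2).
Definition bend (P : A * A) (x : sqr) : sqr :=
  vc (recvC P.1) (vc x (sendB P.2)).

Lemma bd_bent P : bd (bent P) [::] P.1 P.2 (optic_boundary P.1 P.2).
Proof. exact: bd_vc (bd_sendC _) (bd_recvB _). Qed.

Lemma bd_bend P x Y : bd x [::] P.1 P.2 Y ->
  bd (bend P x) (optic_boundary P.1 P.2) I I Y.
Proof.
move=> Hx; rewrite -[Y]cats0.
exact: bd_vc (bd_recvC _) (bd_vc Hx (bd_sendB _)).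
Qed.

Lemma bent_bend P x Y : bd x [::] P.1 P.2 Y -> hc (bent P) (bend P x) = x.
Proof.
move=> Hx; rewrite /bent /bend -(vc_genl (bd_recvB P.2)).
rewrite (hc_vc (bd_sendC P.1) (bd_vc (bd_gen (idm I)) (bd_recvB P.2))
  (bd_recvC P.1) (bd_vc Hx (bd_sendB P.2))).
rewrite (hc_vc (bd_gen (idm I)) (bd_recvB P.2) Hx (bd_sendB P.2)).
by rewrite yankCh yankBh (hc_genl Hx) (vc_genr Hx) (vc_genl Hx).
Qed.

Lemma bend_bent P : bend P (bent P) = Sq (hid (optic_boundary P.1 P.2)).
Proof.
rewrite /bend /bent.
rewrite (vcA (bd_sendC P.1) (bd_recvB P.2) (bd_sendB P.2)) yankBv.
rewrite -(vcA (bd_recvC P.1) (bd_sendC P.1) (bd_hid _)) yankCv.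
by rewrite vcE -hid_mop.
Qed.

(** The pasted cell has trivial top and bottom, so it can be padded by identities
    above and below and then absorbed by interchange. *)
Lemma hc_bend P x c Y Z : bd x [::] P.1 P.2 Y -> bd c Y I I Z ->
  hc (bend P x) c = bend P (hc x c).
Proof.
move=> Hx Hc; rewrite -{1}(vc_genl Hc) -{1}(vc_genr Hc).
rewrite (hc_vc (bd_recvC P.1) (bd_vc Hx (bd_sendB P.2)) (bd_gen (idm I))
  (bd_vc Hc (bd_gen (idm I)))).
rewrite (hc_vc Hx (bd_sendB P.2) Hc (bd_gen (idm I))).
by rewrite (hc_genr (bd_recvC P.1)) (hc_genr (bd_sendB P.2)).
Qed.

Lemma bend_hc P c Y : bd c (optic_boundary P.1 P.2) I I Y ->
  bend P (hc (bent P) c) = c.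
Proof.
by move=> Hc; rewrite -(hc_bend (bd_bent P) Hc) bend_bent (hc_idl Hc).
Qed.

(** The cell of an optic before its left boundary is restored by [bend]. *)
Definition ocell (P Q : A * A) (x : preoptic P Q) : sqr :=
  vc (gen (fwd x)) (vc (send (residual x) Q.1)
    (vc (recv (residual x) Q.2) (gen (bwd x)))).

Lemma bd_ocell P Q (x : preoptic P Q) :
  bd (ocell x) [::] P.1 P.2 (optic_boundary Q.1 Q.2).
Proof.
exact: bd_vc (bd_gen _) (bd_vc (bd_send _ _) (bd_vc (bd_recv _ _) (bd_gen _))).
Qed.

(** An arrow between the residuals passes through both connecting corners. *)
Lemma ocell_slide P Q (x y : preoptic P Q) : slide x y -> ocell x = ocell y.
Proof.
case=> M N f a b; rewrite /ocell /= !gen_comp.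
have Hr := bd_recv N Q.2; have Hb := bd_gen b; have Hf := bd_gen f.
rewrite (vcA (bd_gen a) (bd_gen _) (bd_vc (bd_send N Q.1) (bd_vc Hr Hb))).
rewrite -(vcA (bd_gen _) (bd_send N Q.1) (bd_vc Hr Hb)) gen_send -send_gen.
rewrite (vcA (bd_send M Q.1) Hf (bd_vc Hr Hb)).
rewrite -(vcA Hf Hr Hb) gen_recv -recv_gen.
by rewrite (vcA (bd_recv M Q.2) (bd_gen _) Hb).
Qed.

Lemma ocell_id P : ocell (preoptic_id P) = bent P.
Proof.
rewrite /ocell /=.
have -> : gen (cast erefl (esym (ten_unitl P.1)) (idm P.1)) = gen (idm P.1).
  by apply: gen_Arr; rewrite arr_cast.
have -> : gen (cast (esym (ten_unitl P.2)) erefl (idm P.2)) = gen (idm P.2).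
  by apply: gen_Arr; rewrite arr_cast.
rewrite /send /recv (hc_genl (bd_sendC _)) (hc_genl (bd_recvB _)).
by rewrite (vc_genr (bd_recvB _)) (vc_genl (bd_bent P)).
Qed.

Lemma gen_hc_vc M P Q R (x y : sqr) X Y :
  bd x [::] P Q X -> bd y [::] Q R Y ->
  hc (gen (idm M)) (vc x y) = vc (hc (gen (idm M)) x) (hc (gen (idm M)) y).
Proof.
move=> Hx Hy; rewrite -{1}(vc_genl (bd_gen (idm M))).
by rewrite (hc_vc (bd_gen (idm M)) (bd_gen (idm M)) Hx Hy).
Qed.

(** Padding s°_P by an identity below brings it next to r°_P alone, and the two are
    yanked straight. *)
Lemma send_hc M P x a Y : bd x [::] P a Y ->
  hc (send M P) (vc (recvC P) x) = hc (gen (idm M)) x.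
Proof.
move=> Hx; have Hr := bd_vc (bd_recvC P) Hx.
rewrite (hcA (bd_gen _) (bd_sendC P) Hr); congr hc.
rewrite -{1}(vc_genr (bd_sendC P)).
rewrite (hc_vc (bd_sendC P) (bd_gen (idm I)) (bd_recvC P) Hx).
by rewrite yankCh (hc_genl Hx) (vc_genl Hx).
Qed.

Lemma recv_hc M P x a Y : bd x [::] a P Y ->
  hc (recv M P) (vc x (sendB P)) = hc (gen (idm M)) x.
Proof.
move=> Hx; have Hr := bd_vc Hx (bd_sendB P).
rewrite (hcA (bd_gen _) (bd_recvB P) Hr); congr hc.
rewrite -{1}(vc_genl (bd_recvB P)).
rewrite (hc_vc (bd_gen (idm I)) (bd_recvB P) Hx (bd_sendB P)).
by rewrite yankBh (hc_genl Hx) (vc_genr Hx).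
Qed.

Lemma gen_hc_send (M N P : A) : hc (gen (idm M)) (send N P) = send (M ⊗ N) P.
Proof.
rewrite /send -(hcA (bd_gen (idm M)) (bd_gen (idm N)) (bd_sendC P)).
by rewrite -gen_ten htens_id.
Qed.

Lemma gen_hc_recv (M N P : A) : hc (gen (idm M)) (recv N P) = recv (M ⊗ N) P.
Proof.
rewrite /recv -(hcA (bd_gen (idm M)) (bd_gen (idm N)) (bd_recvB P)).
by rewrite -gen_ten htens_id.
Qed.

(** The connecting corners of the two optics meet in [send_hc] and [recv_hc],
    where they are yanked straight; what remains is the second optic with the
    residual of the first one alongside. *)
Lemma ocell_comp P Q R (x : preoptic P Q) (y : preoptic Q R) :
  ocell (preoptic_comp x y) = hc (ocell x) (bend Q (ocell y)).
Proof.
case: x y => [M a b] [N c d]; rewrite /ocell /preoptic_comp /bend /=.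
have -> : gen (cast erefl (esym (ten_assoc M N R.1)) (a ;; idm M ⊗₁ c))
    = gen (a ;; idm M ⊗₁ c) by apply: gen_Arr; rewrite arr_cast.
have -> : gen (cast (esym (ten_assoc M N R.2)) erefl (idm M ⊗₁ d ;; b))
    = gen (idm M ⊗₁ d ;; b) by apply: gen_Arr; rewrite arr_cast.
have Ha := bd_gen a; have Hb := bd_gen b; have Hc := bd_gen c; have Hd := bd_gen d.
have Hs := bd_send N R.1; have Hr := bd_recv N R.2.
have HU := bd_vc Hc Hs; have HL := bd_vc Hr Hd.
have HL' := bd_vc HL (bd_sendB Q.2).
have HU' := bd_vc (bd_recvC Q.1) HU.
rewrite -[vc (gen c) _](vcA Hc Hs HL) (vcA HU HL (bd_sendB Q.2)).
rewrite -(vcA (bd_recvC Q.1) HU HL').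
(* pad the second optic to four layers matching those of the first *)
rewrite -[in RHS](vc_genl (bd_vc HU' HL')) -[in RHS](vc_genr HL').
have H1 := bd_vc HL' (bd_gen (idm I)).
have H2 := bd_vc (bd_recv M Q.2) Hb.
rewrite (hc_vc Ha (bd_vc (bd_send M Q.1) H2) (bd_gen (idm I)) (bd_vc HU' H1)).
rewrite (hc_vc (bd_send M Q.1) H2 HU' H1).
rewrite (hc_vc (bd_recv M Q.2) Hb HL' (bd_gen (idm I))).
rewrite (hc_genr Ha) (hc_genr Hb) (send_hc _ HU) (recv_hc _ HL).
rewrite (gen_hc_vc _ Hc Hs) (gen_hc_vc _ Hr Hd) -!gen_ten gen_hc_send gen_hc_recv.
rewrite !gen_comp.
have Hs' : bd (send (M ⊗ N) R.1) [::] (M ⊗ (N ⊗ R.1)) (M ⊗ N) R.1°.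
  by rewrite -ten_assoc; apply: bd_send.
have Hr' : bd (recv (M ⊗ N) R.2) [::] (M ⊗ N) (M ⊗ (N ⊗ R.2)) R.2•.
  by rewrite -ten_assoc; apply: bd_recv.
have Hc' := bd_gen (idm M ⊗₁ c); have Hd' := bd_gen (idm M ⊗₁ d).
rewrite (vcA Hr' Hd' Hb) (vcA Hc' Hs' (bd_vc Hr' (bd_vc Hd' Hb))).
by rewrite (vcA Ha Hc' (bd_vc Hs' (bd_vc Hr' (bd_vc Hd' Hb)))).
Qed.

End Bend.

(** * Normal forms of cells with trivial left boundary *)

Section NormalForms.
Variable A : strict_moncat.
Local Notation F := (free_cornering A).
Local Notation sqr := (square (@cell F)).
Local Notation word := (seq (A * polarity)).
Local Notation bd := (@bd F).
Local Notation I := (@unit_ob A).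

(** The stacks that spell out the elements of the profunctor X: one wired corner for
    each port of X, with arrows of the category before, between and after. *)
Inductive nf : word -> A -> A -> sqr -> Prop :=
| nf0 a b (f : hom a b) : nf [::] a b (gen f)
| nfC P X a M b (f : hom a (M ⊗ P)) x : nf X M b x ->
    nf ((P, circ) :: X) a b (vc (gen f) (vc (send M P) x))
| nfB P X a M b (f : hom a M) x : nf X (M ⊗ P) b x ->
    nf ((P, bullet) :: X) a b (vc (gen f) (vc (recv M P) x)).

Lemma nf_bd X a b x : nf X a b x -> bd x [::] a b X.
Proof.
elim=> {X a b x} [a b f|P X a M b f x _ IH|P X a M b f x _ IH].
- exact: bd_gen.
- exact: bd_vc (bd_gen f) (bd_vc (bd_send M P) IH).
- exact: bd_vc (bd_gen f) (bd_vc (bd_recv M P) IH).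
Qed.

Lemma nf_pre X a a' b (g : hom a' a) x : nf X a b x -> nf X a' b (vc (gen g) x).
Proof.
move=> Hx; case: Hx g => {X a b x} [a b f|P X a M b f x Hx|P X a M b f x Hx] g.
- by rewrite -gen_comp; apply: nf0.
- rewrite -(vcA (bd_gen g) (bd_gen f) (bd_vc (bd_send M P) (nf_bd Hx))) -gen_comp.
  exact: nfC.
- rewrite -(vcA (bd_gen g) (bd_gen f) (bd_vc (bd_recv M P) (nf_bd Hx))) -gen_comp.
  exact: nfB.
Qed.

Lemma nf_vc X X' a m b x y :
  nf X a m x -> nf X' m b y -> nf (X ++ X') a b (vc x y).
Proof.
move=> Hx Hy; elim: Hx Hy => {X a m x} [a m f|P X a M m f x Hx IH|P X a M m f x Hx IH] Hy.
- exact: nf_pre.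
- rewrite (vcA (bd_gen f) (bd_vc (bd_send M P) (nf_bd Hx)) (nf_bd Hy)).
  rewrite (vcA (bd_send M P) (nf_bd Hx) (nf_bd Hy)).
  by apply: nfC; apply: IH.
- rewrite (vcA (bd_gen f) (bd_vc (bd_recv M P) (nf_bd Hx)) (nf_bd Hy)).
  rewrite (vcA (bd_recv M P) (nf_bd Hx) (nf_bd Hy)).
  by apply: nfB; apply: IH.
Qed.

Lemma nf0_inv a b x : nf [::] a b x -> exists f : hom a b, x = gen f.
Proof.
by move E: [::] => X H; case: H E => // {}a {}b f _; exists f.
Qed.

Lemma nfC_inv P X a b z : nf ((P, circ) :: X) a b z ->
  exists M (f : hom a (M ⊗ P)) x, z = vc (gen f) (vc (send M P) x) /\ nf X M b x.
Proof.
move E: (_ :: _) => Y H; case: H E => //.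
by move=> P' X' {}a M {}b f x Hx [-> ->]; exists M, f, x.
Qed.

Lemma nfB_inv P X a b z : nf ((P, bullet) :: X) a b z ->
  exists M (f : hom a M) x, z = vc (gen f) (vc (recv M P) x) /\ nf X (M ⊗ P) b x.
Proof.
move E: (_ :: _) => Y H; case: H E => //.
by move=> P' X' {}a M {}b f x Hx [-> ->]; exists M, f, x.
Qed.

Lemma nf_split X X' a b z : nf (X ++ X') a b z ->
  exists m x y, [/\ nf X a m x, nf X' m b y & z = vc x y].
Proof.
elim: X a z => [|[P []] X IH] a z /=.
- move=> Hz; exists a, (gen (idm a)), z; split=> //; first exact: nf0.
  by rewrite (vc_genl (nf_bd Hz)).
- move=> /nfC_inv [M [f [x [-> /IH [m [x' [y [Hx Hy ->]]]]]]]].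
  exists m, (vc (gen f) (vc (send M P) x')), y; split=> //; first exact: nfC.
  rewrite (vcA (bd_gen f) (bd_vc (bd_send M P) (nf_bd Hx)) (nf_bd Hy)).
  by rewrite (vcA (bd_send M P) (nf_bd Hx) (nf_bd Hy)).
- move=> /nfB_inv [M [f [x [-> /IH [m [x' [y [Hx Hy ->]]]]]]]].
  exists m, (vc (gen f) (vc (recv M P) x')), y; split=> //; first exact: nfB.
  rewrite (vcA (bd_gen f) (bd_vc (bd_recv M P) (nf_bd Hx)) (nf_bd Hy)).
  by rewrite (vcA (bd_recv M P) (nf_bd Hx) (nf_bd Hy)).
Qed.

Lemma nf_send P a b (f : hom a b) : nf P° (a ⊗ P) b (hc (gen f) (sendC P)).
Proof.
have := nfC (f ⊗₁ idm P) (nf0 (idm b)).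
by rewrite (vc_genr (bd_send b P)) gen_send.
Qed.

Lemma nf_recv P a b (f : hom a b) : nf P• a (b ⊗ P) (hc (gen f) (recvB P)).
Proof.
have := nfB f (nf0 (idm (b ⊗ P))).
by rewrite (vc_genr (bd_recv b P)) gen_recv.
Qed.

Lemma nf_sendC P : nf P° P I (sendC P).
Proof. by have := nf_send P (idm I); rewrite ten_unitl (hc_genl (bd_sendC P)). Qed.

Lemma nf_recvB P : nf P• I P (recvB P).
Proof. by have := nf_recv P (idm I); rewrite ten_unitl (hc_genl (bd_recvB P)). Qed.

(** For a vertical composite the normal form is cut at the corresponding place of
    its right boundary; for r° and s• the corner meets the port of the normal form
    and disappears by yanking. *)
Lemma nf_act X P Q Y (t : term X P Q Y) a b x :
  nf X a b x -> nf Y (a ⊗ P) (b ⊗ Q) (hc x (tcell t)).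
Proof.
elim: t a b x => {X P Q Y}.
- move=> X Y Z P Q P' Q' t IH t' IH' a b x Hx; rewrite -!ten_assoc.
  rewrite tcell_hcomp -(hcA (nf_bd Hx) (bd_tcell t) (bd_tcell t')).
  by apply: IH'; apply: IH.
- move=> X X' Y Y' P Q R t IH t' IH' a b x /nf_split [m [x1 [x2 [Hx1 Hx2 ->]]]].
  rewrite tcell_vcomp.
  rewrite (hc_vc (nf_bd Hx1) (nf_bd Hx2) (bd_tcell t) (bd_tcell t')).
  exact: nf_vc (IH _ _ _ Hx1) (IH' _ _ _ Hx2).
- by move=> X a b x Hx; rewrite (hc_idr (nf_bd Hx)) !ten_unitr.
- move=> P a b x /nf0_inv [f ->]; rewrite -[tcell _]gen_id -gen_ten; exact: nf0.
- move=> P Q g a b x /nf0_inv [f ->]; rewrite -gen_ten; exact: nf0.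
- move=> P a b x /nf0_inv [f ->]; rewrite ten_unitr; exact: nf_send.
- move=> P a b x /nfC_inv [M [f [z [-> /nf0_inv [g ->]]]]]; rewrite ten_unitr.
  have E : hc (vc (gen f) (vc (send M P) (gen g))) (recvC P)
      = gen (f ;; g ⊗₁ idm P).
    rewrite send_gen gen_comp gen_ten.
    rewrite -{1}(vc_genl (bd_recvC P)).
    rewrite (hc_vc (bd_gen f) (bd_hc (bd_gen g) (bd_sendC P)) (bd_gen (idm I)) (bd_recvC P)).
    rewrite (hc_genr (bd_gen f)) (hcA (bd_gen g) (bd_sendC P) (bd_recvC P)).
    by rewrite yankCh.
  by rewrite E; apply: nf0.
- move=> P a b x /nf0_inv [f ->]; rewrite ten_unitr; exact: nf_recv.
- move=> P a b x /nfB_inv [M [f [z [-> /nf0_inv [g ->]]]]]; rewrite ten_unitr.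
  have E : hc (vc (gen f) (vc (recv M P) (gen g))) (sendB P)
      = gen (f ⊗₁ idm P ;; g).
    rewrite -(vcA (bd_gen f) (bd_recv M P) (bd_gen g)) gen_recv gen_comp gen_ten.
    rewrite -{1}(vc_genr (bd_sendB P)).
    rewrite (hc_vc (bd_hc (bd_gen f) (bd_recvB P)) (bd_gen g) (bd_sendB P) (bd_gen (idm I))).
    rewrite (hc_genr (bd_gen g)) (hcA (bd_gen f) (bd_recvB P) (bd_sendB P)).
    by rewrite yankBh.
  by rewrite E; apply: nf0.
Qed.

(** The normal form of [hc (bent P) c] has two arrows around the port Q.1°; the one
    below it is slid up, which gives an optic. *)
Lemma ocell_surj P Q c :
  bd c (optic_boundary P.1 P.2) I I (optic_boundary Q.1 Q.2) ->
  exists x : preoptic P Q, c = bend P (ocell x).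
Proof.
move=> Hc; have Hc0 := Hc; case: Hc0 => c0 Ec.
have Et : c = tcell (rep c0) by rewrite Ec /tcell repK.
have Hb : nf (optic_boundary P.1 P.2) P.1 P.2 (bent P).
  exact: nf_vc (nf_sendC P.1) (nf_recvB P.2).
have := nf_act (rep c0) Hb; rewrite -Et !ten_unitr.
move=> /nfC_inv [M [f [x [Ex /nfB_inv [N [g [y [Ey /nf0_inv [h Eh]]]]]]]]].
exists (@PreOptic A P Q N (f ;; g ⊗₁ idm Q.1) h).
rewrite -[c in LHS](bend_hc Hc) Ex Ey Eh /ocell /= gen_comp; congr bend.
have Hh := bd_vc (bd_recv N Q.2) (bd_gen h).
rewrite (vcA (bd_gen f) (bd_gen _) (bd_vc (bd_send N Q.1) Hh)).
rewrite -(vcA (bd_gen _) (bd_send N Q.1) Hh) gen_send -send_gen.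
by rewrite (vcA (bd_send M Q.1) (bd_gen g) Hh).
Qed.

End NormalForms.

(** * Combs and the action of cells on them *)

Section Combs.
Variable A : strict_moncat.

Local Notation arr := (arrow (@hom A)).
Local Notation word := (seq (A * polarity)).

Definition arr_id (a : A) : arr := Arr (idm a).

(** The value is junk unless the arrows are composable. *)
Definition arr_mul (f g : arr) : arr :=
  if pselect (arr_cod f = arr_dom g) is left e
  then Arr (arr_hom f ;; cast (esym e) erefl (arr_hom g)) else f.

Definition arr_ten (f g : arr) : arr := Arr (arr_hom f ⊗₁ arr_hom g).

Lemma arr_mulE (a b c : A) (f : hom a b) (g : hom b c) :
  arr_mul (Arr f) (Arr g) = Arr (f ;; g).
Proof.
by rewrite /arr_mul; case: pselect => //= e; rewrite (Prop_irrelevance e erefl).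
Qed.

Lemma arr_ten_assoc (f g h : arr) :
  arr_ten (arr_ten f g) h = arr_ten f (arr_ten g h).
Proof. exact: htens_assoc. Qed.

Lemma arr_ten_unitr (f : arr) : arr_ten f (arr_id unit_ob) = f.
Proof. by rewrite /arr_ten htens_unitr; case: f. Qed.

Lemma arr_ten_unitl (f : arr) : arr_ten (arr_id unit_ob) f = f.
Proof. by rewrite /arr_ten htens_unitl; case: f. Qed.

Lemma arr_ten_id (a b : A) : arr_ten (arr_id a) (arr_id b) = arr_id (a ⊗ b).
Proof. by rewrite /arr_ten /= htens_id. Qed.

(** [comb X a b s]: the list s represents an element of the profunctor X at (a, b).
    It has one more entry than X has ports.  Reading downwards, each port P°
    takes P away from the current object and each P• adds it. *)
Inductive comb : word -> A -> A -> seq arr -> Prop :=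
| comb0 a b (f : hom a b) : comb [::] a b [:: Arr f]
| combC P X a M b (f : hom a (M ⊗ P)) s :
    comb X M b s -> comb ((P, circ) :: X) a b (Arr f :: s)
| combB P X a M b (f : hom a M) s :
    comb X (M ⊗ P) b s -> comb ((P, bullet) :: X) a b (Arr f :: s).

(** Composition of profunctors on representatives: the last arrow of the first
    comb is composed with the first arrow of the second one. *)
Fixpoint star (x y : seq arr) : seq arr :=
  if x is f :: x' then
    if x' is [::] then if y is g :: y' then arr_mul f g :: y' else x
    else f :: star x' y
  else y.
Local Infix "⋆" := star (at level 40, left associativity).

(** The relation of the coends over the intermediate objects: an arrow below a port
    may be moved above it, acquiring or losing the factor P. *)
Inductive comb_eq : word -> A -> A -> seq arr -> seq arr -> Prop :=
| comb_eq_refl X a b s : comb X a b s -> comb_eq X a b s s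
| comb_eq_sym X a b s s' : comb_eq X a b s s' -> comb_eq X a b s' s
| comb_eq_trans X a b s1 s2 s3 :
    comb_eq X a b s1 s2 -> comb_eq X a b s2 s3 -> comb_eq X a b s1 s3
| comb_eq_consC P X a M b (f : hom a (M ⊗ P)) s s' :
    comb_eq X M b s s' ->
    comb_eq ((P, circ) :: X) a b (Arr f :: s) (Arr f :: s')
| comb_eq_consB P X a M b (f : hom a M) s s' :
    comb_eq X (M ⊗ P) b s s' ->
    comb_eq ((P, bullet) :: X) a b (Arr f :: s) (Arr f :: s')
| comb_eq_slideC P X a M N b (f : hom a (M ⊗ P)) (g : hom M N) s :
    comb X N b s ->
    comb_eq ((P, circ) :: X) a b
      (Arr (f ;; g ⊗₁ idm P) :: s) (Arr f :: [:: Arr g] ⋆ s)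
| comb_eq_slideB P X a M N b (f : hom a M) (g : hom M N) s :
    comb X (N ⊗ P) b s ->
    comb_eq ((P, bullet) :: X) a b
      (Arr (f ;; g) :: s) (Arr f :: [:: Arr (g ⊗₁ idm P)] ⋆ s).

Lemma comb0_inv a b s : comb [::] a b s -> exists f : hom a b, s = [:: Arr f].
Proof.
move E: [::] => X H; case: H E => // {}a {}b f _; by exists f.
Qed.

Lemma combC_inv P X a b s : comb ((P, circ) :: X) a b s ->
  exists M (f : hom a (M ⊗ P)) s', s = Arr f :: s' /\ comb X M b s'.
Proof.
move E: (_ :: _) => Y H; case: H E => //.
by move=> P' X' {}a M {}b f s' Hs [-> ->]; exists M, f, s'.
Qed.

Lemma combB_inv P X a b s : comb ((P, bullet) :: X) a b s ->
  exists M (f : hom a M) s', s = Arr f :: s' /\ comb X (M ⊗ P) b s'.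
Proof.
move E: (_ :: _) => Y H; case: H E => //.
by move=> P' X' {}a M {}b f s' Hs [-> ->]; exists M, f, s'.
Qed.

(** Only the first arrow depends on the upper end of a comb, so it can be replaced
    by any arrow with the same codomain. *)
Lemma comb_head X a b s : comb X a b s ->
  exists M (f : hom a M) s', s = Arr f :: s' /\
    forall a' (f' : hom a' M), comb X a' b (Arr f' :: s').
Proof.
case=> [{}a {}b f | P {}X {}a M {}b f s' H | P {}X {}a M {}b f s' H].
- by exists b, f, [::]; split=> // *; apply: comb0.
- by exists (M ⊗ P), f, s'; split=> // *; apply: combC.
- by exists M, f, s'; split=> // *; apply: combB.
Qed.

Lemma star_cons X a b f s y : comb X a b s -> (f :: s) ⋆ y = f :: s ⋆ y.
Proof. by case. Qed.

Lemma comb_pre X a a' b (g : hom a' a) s :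
  comb X a b s -> comb X a' b ([:: Arr g] ⋆ s).
Proof.
by move=> /comb_head [M [f [s' [-> H]]]]; rewrite /= arr_mulE; apply: H.
Qed.

Lemma comb_star X X' a m b x y :
  comb X a m x -> comb X' m b y -> comb (X ++ X') a b (x ⋆ y).
Proof.
elim=> {X a m x} [a m f|P X a M m f s Hs IH|P X a M m f s Hs IH] Hy.
- exact: comb_pre.
- by rewrite (star_cons _ _ Hs); apply: combC; apply: IH.
- by rewrite (star_cons _ _ Hs); apply: combB; apply: IH.
Qed.

Lemma comb_post X a b b' (g : hom b b') s :
  comb X a b s -> comb X a b' (s ⋆ [:: Arr g]).
Proof. by move=> Hs; rewrite -[X]cats0; apply: comb_star Hs (comb0 g). Qed.

Lemma starA X X' X'' a m n b x y z :
  comb X a m x -> comb X' m n y -> comb X'' n b z -> x ⋆ y ⋆ z = x ⋆ (y ⋆ z).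
Proof.
move=> Hx; elim: Hx => {X a m x} [a m f|P X a M m f s Hs IH|P X a M m f s Hs IH] Hy Hz.
- case: Hy Hz f => {m n X' y} [m n g|P X m M n g s Hs|P X m M n g s Hs] Hz f.
  + have [p [h [z' [-> _]]]] := comb_head Hz.
    by rewrite /= !arr_mulE comp_assoc.
  + by rewrite (star_cons _ _ Hs) [_ ⋆ (_ :: s)]/= (star_cons _ _ Hs).
  + by rewrite (star_cons _ _ Hs) [_ ⋆ (_ :: s)]/= (star_cons _ _ Hs).
- by rewrite !(star_cons _ _ Hs) (star_cons _ _ (comb_star Hs Hy)) IH.
- by rewrite !(star_cons _ _ Hs) (star_cons _ _ (comb_star Hs Hy)) IH.
Qed.

Lemma star_idl X a b s : comb X a b s -> [:: arr_id a] ⋆ s = s.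
Proof.
by move=> /comb_head [M [f [s' [-> _]]]]; rewrite /= arr_mulE comp_idl.
Qed.

Lemma star_idr X a b s : comb X a b s -> s ⋆ [:: arr_id b] = s.
Proof.
elim=> {X a b s} [a b f|P X a M b f s Hs IH|P X a M b f s Hs IH].
- by rewrite /= arr_mulE comp_idr.
- by rewrite (star_cons _ _ Hs) IH.
- by rewrite (star_cons _ _ Hs) IH.
Qed.

Lemma comb_eq_comb X a b s s' :
  comb_eq X a b s s' -> comb X a b s /\ comb X a b s'.
Proof.
elim=> {X a b s s'} //; try by move=> *; tauto.
- by move=> P X a M b f s s' _ [? ?]; split; apply: combC.
- by move=> P X a M b f s s' _ [? ?]; split; apply: combB.
- by move=> P X a M N b f g s Hs; split; apply: combC => //; apply: comb_pre.
- by move=> P X a M N b f g s Hs; split; apply: combB => //; apply: comb_pre.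
Qed.

Lemma comb_eq_starl X X' a m b x x' y :
  comb_eq X a m x x' -> comb X' m b y -> comb_eq (X ++ X') a b (x ⋆ y) (x' ⋆ y).
Proof.
elim=> {X a m x x'}.
- by move=> X a m s Hs Hy; apply: comb_eq_refl; apply: comb_star Hs Hy.
- by move=> X a m s s' _ IH Hy; apply: comb_eq_sym; apply: IH.
- by move=> X a m s1 s2 s3 _ IH1 _ IH2 Hy; apply: comb_eq_trans (IH1 Hy) (IH2 Hy).
- move=> P X a M m f s s' /comb_eq_comb [Hs Hs'] IH Hy.
  by rewrite (star_cons _ _ Hs) (star_cons _ _ Hs'); apply: comb_eq_consC; apply: IH.
- move=> P X a M m f s s' /comb_eq_comb [Hs Hs'] IH Hy.
  by rewrite (star_cons _ _ Hs) (star_cons _ _ Hs'); apply: comb_eq_consB; apply: IH.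
- move=> P X a M N m f g s Hs Hy.
  rewrite (star_cons _ _ Hs) (star_cons _ _ (comb_pre g Hs)) (starA (comb0 g) Hs Hy).
  by apply: comb_eq_slideC; apply: comb_star Hs Hy.
- move=> P X a M N m f g s Hs Hy.
  rewrite (star_cons _ _ Hs) (star_cons _ _ (comb_pre _ Hs)) (starA (comb0 _) Hs Hy).
  by apply: comb_eq_slideB; apply: comb_star Hs Hy.
Qed.

Lemma comb_eq_pre X a' a b (g : hom a' a) x x' :
  comb_eq X a b x x' -> comb_eq X a' b ([:: Arr g] ⋆ x) ([:: Arr g] ⋆ x').
Proof.
move=> H; elim: H g => {X a b x x'}.
- by move=> X a m s Hs g; apply: comb_eq_refl; apply: comb_pre.
- by move=> X a m s s' _ IH g; apply: comb_eq_sym.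
- by move=> X a m s1 s2 s3 _ IH1 _ IH2 g; apply: comb_eq_trans (IH1 g) (IH2 g).
- by move=> P X a M m f s s' H _ g /=; rewrite !arr_mulE; apply: comb_eq_consC.
- by move=> P X a M m f s s' H _ g /=; rewrite !arr_mulE; apply: comb_eq_consB.
- move=> P X a M N m f h s Hs g; rewrite [_ ⋆ _]/= [X in comb_eq _ _ _ _ X]/= !arr_mulE.
  by rewrite -comp_assoc; apply: comb_eq_slideC.
- move=> P X a M N m f h s Hs g; rewrite [_ ⋆ _]/= [X in comb_eq _ _ _ _ X]/= !arr_mulE.
  by rewrite -comp_assoc; apply: comb_eq_slideB.
Qed.

Lemma comb_eq_star X X' a m b x x' y y' :
  comb_eq X a m x x' -> comb_eq X' m b y y' ->
  comb_eq (X ++ X') a b (x ⋆ y) (x' ⋆ y').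
Proof.
move=> Hx Hy; have [Hx0 Hx'] := comb_eq_comb Hx; have [Hy0 _] := comb_eq_comb Hy.
apply: comb_eq_trans (comb_eq_starl Hx Hy0) _ => {Hx Hx0 Hy0 x}.
elim: Hx' Hy => {X a m x'} [a m f|P X a M m f s Hs IH|P X a M m f s Hs IH] Hy.
- exact: comb_eq_pre.
- by rewrite !(star_cons _ _ Hs); apply: comb_eq_consC; apply: IH.
- by rewrite !(star_cons _ _ Hs); apply: comb_eq_consB; apply: IH.
Qed.

(** A comb on X ++ X' is cut at the arrow between the two words: the upper part
    keeps this arrow and the lower part starts with an identity. *)
Definition comb_fst (k : nat) (s : seq arr) : seq arr := take k.+1 s.
Definition comb_snd (k : nat) (s : seq arr) : seq arr :=
  arr_id (arr_cod (nth (arr_id unit_ob) s k)) :: drop k.+1 s.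

Lemma comb_fst_cons k f s : comb_fst k.+1 (f :: s) = f :: comb_fst k s.
Proof. by []. Qed.

Lemma comb_snd_cons k f s : comb_snd k.+1 (f :: s) = comb_snd k s.
Proof. by []. Qed.

Lemma comb_split X X' a b s : comb (X ++ X') a b s -> exists m,
  [/\ comb X a m (comb_fst (size X) s), comb X' m b (comb_snd (size X) s)
    & s = comb_fst (size X) s ⋆ comb_snd (size X) s].
Proof.
elim: X a s => [|[P []] X IH] a s /=.
- move=> /comb_head [m [f [s' [-> H]]]].
  exists m; rewrite /comb_fst /comb_snd /= take0 drop0 arr_mulE comp_idr.
  by split=> //; [apply: comb0 | apply: H].
- move=> /combC_inv [M [f [s' [-> /IH [m [H1 H2 H3]]]]]]; exists m.
  split=> //; first exact: combC.
  by rewrite comb_snd_cons (star_cons _ _ H1) -H3.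
- move=> /combB_inv [M [f [s' [-> /IH [m [H1 H2 H3]]]]]]; exists m.
  split=> //; first exact: combB.
  by rewrite comb_snd_cons (star_cons _ _ H1) -H3.
Qed.

Lemma comb_fst_pre k X a' a b (g : hom a' a) s :
  comb X a b s -> comb_fst k ([:: Arr g] ⋆ s) = [:: Arr g] ⋆ comb_fst k s.
Proof. by move=> /comb_head [m [f [s' [-> _]]]]. Qed.

Lemma comb_snd_pre k X a' a b (g : hom a' a) s :
  comb X a b s -> comb_snd k ([:: Arr g] ⋆ s) = comb_snd k s.
Proof.
by move=> /comb_head [m [f [s' [-> _]]]]; case: k => //; rewrite /= arr_mulE.
Qed.

(** K x y is compatible with sliding in x and in y and with moving an arrow from
    the end of x to the beginning of y, so it defines a map out of the composite of
    the profunctors X and X'; R is the equality of the target.  The upper end a is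
    fixed, which is what allows induction on X by absorbing arrows into K. *)
Record balanced (R : seq arr -> seq arr -> Prop)
    (K : seq arr -> seq arr -> seq arr) (X X' : word) (a b : A) : Prop := {
  bal_sym : forall x y, R x y -> R y x;
  bal_trans : forall x y z, R x y -> R y z -> R x z;
  bal_l : forall m x x' y, comb_eq X a m x x' -> comb X' m b y ->
    R (K x y) (K x' y);
  bal_r : forall m x y y', comb X a m x -> comb_eq X' m b y y' ->
    R (K x y) (K x y');
  bal_m : forall m m' (g : hom m m') x y, comb X a m x -> comb X' m' b y ->
    R (K (x ⋆ [:: Arr g]) y) (K x ([:: Arr g] ⋆ y)) }.

Lemma balanced_consC R K P X X' a M b (f : hom a (M ⊗ P)) :
  balanced R K ((P, circ) :: X) X' a b ->
  balanced R (fun x => K (Arr f :: x)) X X' M b.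
Proof.
case=> symR trR Kl Kr Km; split=> //.
- by move=> m x x' y Hx; apply: Kl; apply: comb_eq_consC.
- by move=> m x y y' Hx; apply: Kr; apply: combC.
- by move=> m m' g x y Hx; rewrite -(star_cons _ _ Hx); apply: Km; apply: combC.
Qed.

Lemma balanced_consB R K P X X' a M b (f : hom a M) :
  balanced R K ((P, bullet) :: X) X' a b ->
  balanced R (fun x => K (Arr f :: x)) X X' (M ⊗ P) b.
Proof.
case=> symR trR Kl Kr Km; split=> //.
- by move=> m x x' y Hx; apply: Kl; apply: comb_eq_consB.
- by move=> m x y y' Hx; apply: Kr; apply: combB.
- by move=> m m' g x y Hx; rewrite -(star_cons _ _ Hx); apply: Km; apply: combB.
Qed.

(** The cut of x ⋆ y need not be (x, y), but differs from it by one arrow moved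
    across the junction. *)
Lemma balanced_split_star R K X X' a m b x y :
  balanced R K X X' a b -> comb X a m x -> comb X' m b y ->
  R (K (comb_fst (size X) (x ⋆ y)) (comb_snd (size X) (x ⋆ y))) (K x y).
Proof.
move=> KK Hx; elim: Hx K KK => {X a m x}
  [a m f|P X a M m f s Hs IH|P X a M m f s Hs IH] K KK Hy.
- have [p [h [y' [Ey Hy']]]] := comb_head Hy.
  have K1 := bal_m KK f (comb0 (idm a)) Hy.
  have K2 := bal_m KK (f ;; h) (comb0 (idm a)) (Hy' _ (idm p)).
  move: K1 K2; rewrite Ey /= !arr_mulE !comp_idl comp_idr.
  rewrite /comb_fst /comb_snd /= take0 drop0.
  by move=> /(bal_sym KK) K1 K2; apply: (bal_trans KK) K2 K1.
- rewrite (star_cons _ _ Hs) [size _]/= comb_fst_cons comb_snd_cons.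
  exact: IH (balanced_consC _ KK) Hy.
- rewrite (star_cons _ _ Hs) [size _]/= comb_fst_cons comb_snd_cons.
  exact: IH (balanced_consB _ KK) Hy.
Qed.

Lemma balanced_split_eq R K X X' a b s s' :
  balanced R K X X' a b -> comb_eq (X ++ X') a b s s' ->
  R (K (comb_fst (size X) s) (comb_snd (size X) s))
    (K (comb_fst (size X) s') (comb_snd (size X) s')).
Proof.
elim: X a b s s' K => [|p X IH] a b s s' K KK Hss.
  have [Hs Hs'] := comb_eq_comb Hss.
  (* for the empty word the upper part can be normalised to an identity *)
  have E u : comb X' a b u ->
      R (K (comb_fst 0 u) (comb_snd 0 u)) (K [:: arr_id a] u).
    move=> Hu; have := balanced_split_star KK (comb0 (idm a)) Hu.
    by rewrite (star_idl Hu).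
  apply: (bal_trans KK) (E _ Hs) _.
  apply: (bal_trans KK) _ (bal_sym KK (E _ Hs')).
  exact: (bal_r KK (comb0 (idm a)) Hss).
move EY: ((p :: X) ++ X') Hss => Y Hss.
elim: Hss p EY K KK => {Y a b s s'}.
- move=> Y a b s Hs p EY K KK; move: Hs; rewrite -EY => /comb_split [m [H1 H2 _]].
  by apply: (bal_l KK) H2; apply: comb_eq_refl.
- by move=> Y a b s s' _ IH' p EY K KK; apply: (bal_sym KK); apply: IH'.
- move=> Y a b s1 s2 s3 _ IH1 _ IH2 p EY K KK.
  exact: (bal_trans KK) (IH1 _ EY _ KK) (IH2 _ EY _ KK).
- move=> P Y a M b f s s' Hs _ _ [-> EY] K KK; rewrite -{}EY in Hs.
  exact: IH (balanced_consC _ KK) Hs.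
- move=> P Y a M b f s s' Hs _ _ [-> EY] K KK; rewrite -{}EY in Hs.
  exact: IH (balanced_consB _ KK) Hs.
- move=> P Y a M N b f g s Hs _ [-> EY] K KK; rewrite -{}EY in Hs.
  rewrite [size _]/= !comb_snd_cons !comb_fst_cons.
  rewrite (comb_snd_pre _ _ Hs) (comb_fst_pre _ _ Hs).
  have [m [H1 H2 _]] := comb_split Hs.
  by apply: (bal_l KK) H2; apply: comb_eq_slideC.
- move=> P Y a M N b f g s Hs _ [-> EY] K KK; rewrite -{}EY in Hs.
  rewrite [size _]/= !comb_snd_cons !comb_fst_cons.
  rewrite (comb_snd_pre _ _ Hs) (comb_fst_pre _ _ Hs).
  have [m [H1 H2 _]] := comb_split Hs.
  by apply: (bal_l KK) H2; apply: comb_eq_slideB.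
Qed.

(** Functoriality of the composition of profunctors, on representatives. *)
Definition vapp (k : nat) (phi psi : seq arr -> seq arr) (s : seq arr) :=
  phi (comb_fst k s) ⋆ psi (comb_snd k s).

(** The interpretation of a term as a natural map.  Horizontal composition is
    composition of functions; s° and r• apply - ⊗ P to an arrow, while r° and s•
    collapse the coend for the port, an instance of the Yoneda lemma.  On lists of
    the wrong length the value is junk. *)
Fixpoint act X P Q Y (t : term X P Q Y) (s : seq arr) : seq arr :=
  match t with
  | Thcomp _ _ _ _ _ _ _ t1 t2 => act t2 (act t1 s)
  | Tvcomp X1 _ _ _ _ _ _ t1 t2 =>
      vapp (size (X1 : word)) (act t1) (act t2) s
  | Thid _ => s
  | Tvid P => [seq arr_ten f (arr_id P) | f <- s]
  | Tgen _ _ g => [seq arr_ten f (Arr g) | f <- s]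
  | TsendC P =>
      if s is [:: f] then [:: arr_ten f (arr_id P); arr_id (arr_cod f)] else s
  | TrecvC P =>
      if s is [:: f; g] then [:: arr_mul f (arr_ten g (arr_id P))] else s
  | TrecvB P =>
      if s is [:: f] then [:: arr_id (arr_dom f); arr_ten f (arr_id P)] else s
  | TsendB P =>
      if s is [:: f; g] then [:: arr_mul (arr_ten f (arr_id P)) g] else s
  end.

(** phi is a natural map from the profunctor X to the restriction of the profunctor
    Y along - ⊗ P and - ⊗ Q. *)
Record natural (X : word) (P Q : A) (Y : word) (phi : seq arr -> seq arr) := {
  nat_eq : forall a b s s', comb_eq X a b s s' ->
    comb_eq Y (a ⊗ P) (b ⊗ Q) (phi s) (phi s');
  nat_pre : forall a' a b (g : hom a' a) s, comb X a b s ->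
    comb_eq Y (a' ⊗ P) (b ⊗ Q)
      (phi ([:: Arr g] ⋆ s)) ([:: Arr (g ⊗₁ idm P)] ⋆ phi s);
  nat_post : forall a b b' (g : hom b b') s, comb X a b s ->
    comb_eq Y (a ⊗ P) (b' ⊗ Q)
      (phi (s ⋆ [:: Arr g])) (phi s ⋆ [:: Arr (g ⊗₁ idm Q)]) }.

Lemma nat_comb X P Q Y phi a b s : natural X P Q Y phi ->
  comb X a b s -> comb Y (a ⊗ P) (b ⊗ Q) (phi s).
Proof. by move=> /nat_eq N /(comb_eq_refl (s := s)) /N /comb_eq_comb []. Qed.

Section Vertical.
Variables (X X' Y Y' : word) (P Q R : A) (phi psi : seq arr -> seq arr).
Hypotheses (Nphi : natural X P Q Y phi) (Npsi : natural X' Q R Y' psi).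

(** Moving an arrow across the junction is naturality of both maps at the
    intermediate object. *)
Lemma vapp_balanced a b :
  balanced (comb_eq (Y ++ Y') (a ⊗ P) (b ⊗ R)) (fun x y => phi x ⋆ psi y)
    X X' a b.
Proof.
split.
- by move=> x y; apply: comb_eq_sym.
- by move=> x y z; apply: comb_eq_trans.
- move=> m x x' y Hx Hy.
  exact: comb_eq_star (nat_eq Nphi Hx) (comb_eq_refl (nat_comb Npsi Hy)).
- move=> m x y y' Hx Hy.
  exact: comb_eq_star (comb_eq_refl (nat_comb Nphi Hx)) (nat_eq Npsi Hy).
- move=> m m' g x y Hx Hy.
  have H1 := comb_eq_star (nat_post Nphi g Hx) (comb_eq_refl (nat_comb Npsi Hy)).
  have H2 := comb_eq_star (comb_eq_refl (nat_comb Nphi Hx)) (nat_pre Npsi g Hy).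
  apply: comb_eq_trans H1 _; apply: comb_eq_trans (comb_eq_sym H2).
  rewrite (starA (nat_comb Nphi Hx) (comb0 _) (nat_comb Npsi Hy)).
  by apply: comb_eq_refl; case/comb_eq_comb: H2 => _.
Qed.

Lemma vapp_star a m b x y : comb X a m x -> comb X' m b y ->
  comb_eq (Y ++ Y') (a ⊗ P) (b ⊗ R)
    (vapp (size X) phi psi (x ⋆ y)) (phi x ⋆ psi y).
Proof. exact: balanced_split_star (vapp_balanced a b). Qed.

Lemma vapp_natural :
  natural (X ++ X') P R (Y ++ Y') (vapp (size X) phi psi).
Proof.
split.
- move=> a b s s'; exact: balanced_split_eq (vapp_balanced a b).
- move=> a' a b g s /comb_split [m [Hx Hy ->]].
  move: (comb_fst _ _) (comb_snd _ _) Hx Hy => x y Hx Hy.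
  rewrite -(starA (comb0 g) Hx Hy).
  apply: comb_eq_trans (vapp_star (comb_pre g Hx) Hy) _.
  have Hy' := nat_comb Npsi Hy.
  apply: comb_eq_trans (comb_eq_star (nat_pre Nphi g Hx) (comb_eq_refl Hy')) _.
  rewrite (starA (comb0 _) (nat_comb Nphi Hx) Hy').
  by apply: comb_eq_pre; apply: comb_eq_sym; exact: vapp_star Hx Hy.
- move=> a b b' g s /comb_split [m [Hx Hy ->]].
  move: (comb_fst _ _) (comb_snd _ _) Hx Hy => x y Hx Hy.
  rewrite (starA Hx Hy (comb0 g)).
  apply: comb_eq_trans (vapp_star Hx (comb_post g Hy)) _.
  have Hx' := nat_comb Nphi Hx.
  apply: comb_eq_trans (comb_eq_star (comb_eq_refl Hx') (nat_post Npsi g Hy)) _.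
  rewrite -(starA Hx' (nat_comb Npsi Hy) (comb0 _)).
  rewrite -[Y ++ Y']cats0.
  apply: comb_eq_star (comb_eq_refl (comb0 _)).
  by apply: comb_eq_sym; exact: vapp_star Hx Hy.
Qed.
End Vertical.

Lemma comb_eq0 a b s s' : comb_eq [::] a b s s' -> s = s'.
Proof.
move E: [::] => X H; elim: H E => // {}X {}a {}b => [s1 s2 _ IH /IH //|s1 s2 s3 _ IH1 _ IH2 E].
by rewrite IH1 // IH2.
Qed.

(** A comb without ports is a single arrow, so there is nothing to slide. *)
Lemma gen_natural P Q (g : hom P Q) :
  natural [::] P Q [::] (map (fun f => arr_ten f (Arr g))).
Proof.
split.
- move=> a b s s' Hs; rewrite -(comb_eq0 Hs).
  have [/comb0_inv [f ->] _] := comb_eq_comb Hs.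
  by apply: comb_eq_refl; apply: comb0.
- move=> a' a b h s /comb0_inv [f ->]; rewrite /= !arr_mulE /arr_ten /=.
  rewrite -htens_comp comp_idl; apply: comb_eq_refl; exact: comb0.
- move=> a b b' h s /comb0_inv [f ->]; rewrite /= !arr_mulE /arr_ten /=.
  rewrite -htens_comp comp_idr; apply: comb_eq_refl; exact: comb0.
Qed.

Lemma hcomp_natural X Y Z P Q P' Q' phi psi :
  natural X P Q Y phi -> natural Y P' Q' Z psi ->
  natural X (P ⊗ P') (Q ⊗ Q') Z (fun s => psi (phi s)).
Proof.
move=> Nphi Npsi; split.
- by move=> a b s s' Hs; rewrite -!ten_assoc; apply: (nat_eq Npsi); apply: (nat_eq Nphi).
- move=> a' a b g s Hs; rewrite -htens_id -(htens_assoc g) -!ten_assoc.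
  apply: comb_eq_trans (nat_pre Npsi (g ⊗₁ idm P) (nat_comb Nphi Hs)).
  by apply: (nat_eq Npsi); apply: (nat_pre Nphi).
- move=> a b b' g s Hs; rewrite -htens_id -(htens_assoc g) -!ten_assoc.
  apply: comb_eq_trans (nat_post Npsi (g ⊗₁ idm Q) (nat_comb Nphi Hs)).
  by apply: (nat_eq Npsi); apply: (nat_post Nphi).
Qed.

Lemma id_natural X : natural X unit_ob unit_ob X id.
Proof.
split.
- by move=> a b s s'; rewrite !ten_unitr.
- move=> a' a b g s Hs; rewrite htens_unitr !ten_unitr.
  by apply: comb_eq_refl; apply: comb_pre.
- move=> a b b' g s Hs; rewrite htens_unitr !ten_unitr.
  by apply: comb_eq_refl; apply: comb_post.
Qed.

(** Precomposition commutes strictly; postcomposition commutes up to sliding the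
    arrow along the new port. *)
Lemma sendC_natural P : natural [::] P unit_ob (port P circ)
  (fun s => if s is [:: f] then [:: arr_ten f (arr_id P); arr_id (arr_cod f)] else s).
Proof.
split.
- move=> a b s s' Hs; rewrite -(comb_eq0 Hs) !ten_unitr.
  have [/comb0_inv [f ->] _] := comb_eq_comb Hs.
  by apply: comb_eq_refl; apply: combC; apply: comb0.
- move=> a' a b h s /comb0_inv [f ->] /=; rewrite ten_unitr arr_mulE /= arr_mulE.
  rewrite /arr_ten /= -htens_comp comp_idl.
  by apply: comb_eq_refl; apply: combC; apply: comb0.
- move=> a b b' h s /comb0_inv [f ->] /=.
  rewrite htens_unitr ten_unitr !arr_mulE /=.
  have := comb_eq_slideC (f ⊗₁ idm P) h (comb0 (idm b')).
  by rewrite /= arr_mulE -htens_comp !comp_idl comp_idr.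
Qed.

Lemma recvB_natural P : natural [::] unit_ob P (port P bullet)
  (fun s => if s is [:: f] then [:: arr_id (arr_dom f); arr_ten f (arr_id P)] else s).
Proof.
split.
- move=> a b s s' Hs; rewrite -(comb_eq0 Hs) !ten_unitr.
  have [/comb0_inv [f ->] _] := comb_eq_comb Hs.
  by apply: comb_eq_refl; apply: combB; apply: comb0.
- move=> a' a b h s /comb0_inv [f ->] /=.
  rewrite htens_unitr ten_unitr !arr_mulE /=.
  have := comb_eq_sym (comb_eq_slideB (idm a') h (comb0 (f ⊗₁ idm P))).
  by rewrite /= arr_mulE /arr_ten /= -htens_comp !comp_idl comp_idr.
- move=> a b b' h s /comb0_inv [f ->] /=; rewrite ten_unitr !arr_mulE /=.
  rewrite /arr_ten /= -htens_comp comp_idl.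
  by apply: comb_eq_refl; apply: combB; apply: comb0.
Qed.

Lemma combC1_inv P a b s : comb (port P circ) a b s ->
  exists M (f : hom a (M ⊗ P)) (g : hom M b), s = [:: Arr f; Arr g].
Proof.
by move=> /combC_inv [M [f [s' [-> /comb0_inv [g ->]]]]]; exists M, f, g.
Qed.

Lemma combB1_inv P a b s : comb (port P bullet) a b s ->
  exists M (f : hom a M) (g : hom (M ⊗ P) b), s = [:: Arr f; Arr g].
Proof.
by move=> /combB_inv [M [f [s' [-> /comb0_inv [g ->]]]]]; exists M, f, g.
Qed.

Lemma recvC_natural P : natural (port P circ) unit_ob P [::]
  (fun s => if s is [:: f; g] then [:: arr_mul f (arr_ten g (arr_id P))] else s).
Proof.
set phi := fun s : seq arr => _.
have Hphi a b s : comb (port P circ) a b s -> comb [::] a (b ⊗ P) (phi s).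
  by move=> /combC1_inv [M [f [g ->]]]; rewrite /= arr_mulE; apply: comb0.
have Ephi a b s s' : comb_eq (port P circ) a b s s' -> phi s = phi s'.
  move EX: (port P circ) => X H; elim: H EX => {X a b s s'} //.
  - by move=> X a b s s' _ IH /IH.
  - by move=> X a b s1 s2 s3 _ IH1 _ IH2 EX; rewrite IH1 // IH2.
  - by move=> Q X a M b f s s' Hs _ [_ EX]; rewrite -EX in Hs; rewrite (comb_eq0 Hs).
  - move=> Q X a M N b f g s Hs [EP EX]; rewrite -{}EX -{}EP in f Hs *.
    have [h ->] := comb0_inv Hs.
    by rewrite /= !arr_mulE /arr_ten /= ?arr_mulE comp_assoc -htens_comp comp_idl.
split.
- move=> a b s s' Hs; rewrite ten_unitr -(Ephi _ _ _ _ Hs).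
  by apply: comb_eq_refl; apply: Hphi; case: (comb_eq_comb Hs).
- move=> a' a b g s Hs; rewrite htens_unitr ten_unitr.
  have [M [f [h Es]]] := combC1_inv Hs.
  have E : phi ([:: Arr g] ⋆ s) = [:: Arr g] ⋆ phi s.
    by rewrite Es /= arr_mulE /arr_ten /= ?arr_mulE comp_assoc.
  by rewrite E; apply: comb_eq_refl; apply: comb_pre; apply: Hphi.
- move=> a b b' g s Hs; rewrite ten_unitr.
  have [M [f [h Es]]] := combC1_inv Hs.
  have E : phi (s ⋆ [:: Arr g]) = phi s ⋆ [:: Arr (g ⊗₁ idm P)].
    rewrite Es /= arr_mulE /arr_ten /= ?arr_mulE comp_assoc.
    by rewrite -htens_comp comp_idl.
  by rewrite E; apply: comb_eq_refl; apply: comb_post; apply: Hphi.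
Qed.

Lemma sendB_natural P : natural (port P bullet) P unit_ob [::]
  (fun s => if s is [:: f; g] then [:: arr_mul (arr_ten f (arr_id P)) g] else s).
Proof.
set phi := fun s : seq arr => _.
have Hphi a b s : comb (port P bullet) a b s -> comb [::] (a ⊗ P) b (phi s).
  by move=> /combB1_inv [M [f [g ->]]]; rewrite /= arr_mulE; apply: comb0.
have Ephi a b s s' : comb_eq (port P bullet) a b s s' -> phi s = phi s'.
  move EX: (port P bullet) => X H; elim: H EX => {X a b s s'} //.
  - by move=> X a b s s' _ IH /IH.
  - by move=> X a b s1 s2 s3 _ IH1 _ IH2 EX; rewrite IH1 // IH2.
  - by move=> Q X a M b f s s' Hs _ [_ EX]; rewrite -EX in Hs; rewrite (comb_eq0 Hs).
  - move=> Q X a M N b f g s Hs [EP EX]; rewrite -{}EX -{}EP in Hs *.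
    have [h ->] := comb0_inv Hs.
    by rewrite /= !arr_mulE /arr_ten /= ?arr_mulE -comp_assoc -htens_comp comp_idl.
split.
- move=> a b s s' Hs; rewrite ten_unitr -(Ephi _ _ _ _ Hs).
  by apply: comb_eq_refl; apply: Hphi; case: (comb_eq_comb Hs).
- move=> a' a b g s Hs; rewrite ten_unitr.
  have [M [f [h Es]]] := combB1_inv Hs.
  have E : phi ([:: Arr g] ⋆ s) = [:: Arr (g ⊗₁ idm P)] ⋆ phi s.
    rewrite Es /= arr_mulE /arr_ten /= ?arr_mulE -comp_assoc.
    by rewrite -htens_comp comp_idl.
  by rewrite E; apply: comb_eq_refl; apply: comb_pre; apply: Hphi.
- move=> a b b' g s Hs; rewrite htens_unitr ten_unitr.
  have [M [f [h Es]]] := combB1_inv Hs.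
  have E : phi (s ⋆ [:: Arr g]) = phi s ⋆ [:: Arr g].
    by rewrite Es /= arr_mulE /arr_ten /= ?arr_mulE comp_assoc.
  by rewrite E; apply: comb_eq_refl; apply: comb_post; apply: Hphi.
Qed.

Lemma act_natural X P Q Y (t : term X P Q Y) : natural X P Q Y (act t).
Proof.
elim: t => {X P Q Y}.
- by move=> X Y Z P Q P' Q' t1 N1 t2 N2; apply: hcomp_natural N1 N2.
- by move=> X X' Y Y' P Q R t1 N1 t2 N2; apply: vapp_natural N1 N2.
- exact: id_natural.
- by move=> P; apply: gen_natural.
- exact: gen_natural.
- exact: sendC_natural.
- exact: recvC_natural.
- exact: recvB_natural.
- exact: sendB_natural.
Qed.

Lemma act_comb X P Q Y (t : term X P Q Y) a b s :
  comb X a b s -> comb Y (a ⊗ P) (b ⊗ Q) (act t s).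
Proof. exact: nat_comb (act_natural t). Qed.

Lemma act_vcomp X X' Y Y' P Q R (t : term X P Q Y) (t' : term X' Q R Y')
    a m b x y : comb X a m x -> comb X' m b y ->
  comb_eq (Y ++ Y') (a ⊗ P) (b ⊗ R) (act (Tvcomp t t') (x ⋆ y)) (act t x ⋆ act t' y).
Proof. exact: vapp_star (act_natural t) (act_natural t') _ _ _ _ _. Qed.

Lemma act_vid (a P : A) : act (Tvid P) [:: arr_id a] = [:: arr_id (a ⊗ P)].
Proof. by rewrite /= /arr_ten /= htens_id. Qed.

Definition act_eq (t t' : square (@term A)) : Prop :=
  forall a b s, comb (sq_left t) a b s ->
    comb_eq (sq_right t) (a ⊗ sq_top t) (b ⊗ sq_bot t)
      (act (sq_cell t) s) (act (sq_cell t') s).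

(** For the axioms involving vertical composition the comb is cut along the word and
    [act_vcomp] is applied on both sides.  The horizontal yanking equations hold
    strictly and the vertical ones up to one slide. *)
Lemma act_sound t t' : ceq t t' -> act_eq t t'.
Proof.
elim=> {t t'}.
- by move=> t a b s Hs; apply: comb_eq_refl; apply: act_comb.
- move=> t t' H IH a b s; have [El Et Eb Er] := ceq_boundary H.
  have := IH a b s; move: (act _ s) (act _ s) => u v.
  by rewrite El Et Eb Er => {}IH Hs; apply: comb_eq_sym; apply: IH.
- move=> t1 t2 t3 H IH _ IH' a b s; have [El Et Eb Er] := ceq_boundary H.
  have := IH a b s; have := IH' a b s.
  move: (act _ s) (act _ s) (act _ s) => u v w; rewrite El Et Eb Er.
  by move=> {}IH' {}IH Hs; apply: comb_eq_trans (IH Hs) (IH' Hs).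
- move=> X Y Z P Q P' Q' X1 Y1 Z1 P1 Q1 P1' Q1' t u t1 u1.
  move=> H IH H' IH' a b s Hs.
  have [/= El Et Eb Er] := ceq_boundary H; have [/= El' Et' Eb' Er'] := ceq_boundary H'.
  subst X1 Y1 Z1 P1 Q1 P1' Q1'; rewrite /= -!ten_assoc.
  apply: comb_eq_trans (nat_eq (act_natural u1) (IH _ _ _ Hs)).
  by apply: IH'; apply: act_comb.
- move=> X X' Y Y' P Q R X1 X1' Y1 Y1' P1 Q1 R1 t u t1 u1.
  move=> H IH H' IH' a b s Hs.
  have [/= El Et Eb Er] := ceq_boundary H; have [/= El' Et' Eb' Er'] := ceq_boundary H'.
  subst X1 Y1 X1' Y1' P1 Q1 R1.
  have [m [Hx Hy _]] := comb_split Hs.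
  exact: comb_eq_star (IH _ _ _ Hx) (IH' _ _ _ Hy).
- by move=> X Y Z W P Q P' Q' P'' Q'' t u v a b s Hs; apply: comb_eq_refl;
    exact: (act_comb (Thcomp (Thcomp t u) v) Hs).
- by move=> X Y P Q t a b s Hs; apply: comb_eq_refl;
    exact: (act_comb (Thcomp (Thid X) t) Hs).
- by move=> X Y P Q t a b s Hs; apply: comb_eq_refl;
    exact: (act_comb (Thcomp t (Thid Y)) Hs).
- move=> X X' X'' Y Y' Y'' P Q R S t u v a b s Hs.
  move: Hs => /comb_split [m [Hx Hz ->]]; move: (comb_fst _ _) (comb_snd _ _) Hx Hz.
  move=> x z /comb_split [n [Hx Hy ->]]; move: (comb_fst _ _) (comb_snd _ _) Hx Hy.
  move=> {}x y Hx Hy Hz; rewrite [sq_right _]/= [sq_top _]/= [sq_bot _]/=.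
  apply: comb_eq_trans (act_vcomp (Tvcomp t u) v (comb_star Hx Hy) Hz) _.
  apply: comb_eq_trans (comb_eq_starl (act_vcomp t u Hx Hy) (act_comb v Hz)) _.
  rewrite (starA Hx Hy Hz) (starA (act_comb t Hx) (act_comb u Hy) (act_comb v Hz)).
  apply: comb_eq_sym; rewrite -catA.
  apply: comb_eq_trans (act_vcomp t (Tvcomp u v) Hx (comb_star Hy Hz)) _.
  exact: comb_eq_star (comb_eq_refl (act_comb t Hx)) (act_vcomp u v Hy Hz).
- move=> X Y P Q t a b s Hs; rewrite [sq_right _]/= [sq_top _]/= [sq_bot _]/=.
  have := act_vcomp (Tvid P) t (comb0 (idm a)) Hs.
  by rewrite (star_idl Hs) act_vid (star_idl (act_comb t Hs)).
- move=> X Y P Q t a b s /=; rewrite {1}cats0 => Hs.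
  have := act_vcomp t (Tvid Q) Hs (comb0 (idm b)).
  by rewrite (star_idr Hs) act_vid (star_idr (act_comb t Hs)).
- move=> X Y a b s Hs; rewrite [sq_right _]/= [sq_top _]/= [sq_bot _]/=.
  rewrite [act (sq_cell (Sq (Thid _))) _]/=.
  move: Hs => /comb_split [m [Hx Hy ->]]; move: (comb_fst _ _) (comb_snd _ _) Hx Hy.
  move=> x y Hx Hy; apply: comb_eq_sym; rewrite ten_unitr.
  have := act_vcomp (Thid X) (Thid Y) Hx Hy.
  by rewrite !ten_unitr.
- move=> P Q a b s /comb0_inv [f ->]; rewrite [act _ _]/= [X in comb_eq _ _ _ _ X]/=.
  rewrite arr_ten_assoc /arr_ten /= htens_id.
  by apply: comb_eq_refl; apply: comb0.
- move=> a b s /comb0_inv [f ->]; rewrite /= arr_ten_unitr !ten_unitr.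
  by apply: comb_eq_refl; apply: comb0.
- move=> X X' Y Y' Z Z' P Q R P' Q' R' t u v w a b s.
  move=> /comb_split [m [Hx Hy ->]]; move: (comb_fst _ _) (comb_snd _ _) Hx Hy.
  move=> x y Hx Hy; rewrite [sq_right _]/= [sq_top _]/= [sq_bot _]/= -!ten_assoc.
  have Hx' := act_comb t Hx; have Hy' := act_comb u Hy.
  have E1 := nat_eq (act_natural (Tvcomp v w)) (act_vcomp t u Hx Hy).
  apply: comb_eq_trans E1 _.
  apply: comb_eq_trans (act_vcomp v w Hx' Hy') _.
  by have := comb_eq_sym (act_vcomp (Thcomp t v) (Thcomp u w) Hx Hy); rewrite -!ten_assoc.
- move=> P Q R f g a b s /comb0_inv [h ->]; rewrite /sq_right /sq_top /sq_bot.
  have := comb_eq_sym (act_vcomp (Tgen f) (Tgen g) (comb0 h) (comb0 (idm b))).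
  rewrite /= !arr_mulE /arr_ten /= ?arr_mulE comp_idr => H.
  apply: comb_eq_trans H; rewrite -htens_comp comp_idr.
  by apply: comb_eq_refl; apply: comb0.
- by move=> P a b s /comb0_inv [h ->]; apply: comb_eq_refl; apply: comb0.
- move=> P Q R S f g a b s /comb0_inv [h ->]; rewrite /= arr_ten_assoc.
  by apply: comb_eq_refl; apply: comb0.
- move=> P a b s /comb0_inv [h ->].
  rewrite /= arr_mulE -htens_comp comp_idl comp_idr ten_unitr ten_unitl.
  by apply: comb_eq_refl; apply: comb0.
- move=> P a b s /combC1_inv [M [f [g ->]]]; rewrite /sq_right /sq_top /sq_bot.
  rewrite !ten_unitr.
  have := act_vcomp (TrecvC P) (TsendC P) (combC f (comb0 g)) (comb0 (idm b)).
  rewrite !ten_unitr /= !arr_mulE /arr_ten /= htens_id !comp_idr => H.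
  apply: comb_eq_trans H _.
  have := comb_eq_slideC f g (comb0 (idm b)).
  by rewrite /= arr_mulE comp_idr.
- move=> P a b s /comb0_inv [h ->].
  rewrite /= arr_mulE htens_id comp_idl ten_unitr ten_unitl.
  by apply: comb_eq_refl; apply: comb0.
- move=> P a b s /combB1_inv [M [f [g ->]]]; rewrite /sq_right /sq_top /sq_bot.
  rewrite !ten_unitr.
  have := act_vcomp (TrecvB P) (TsendB P) (comb0 (idm a)) (combB f (comb0 g)).
  rewrite !ten_unitr /= !arr_mulE comp_idl /arr_ten /= => H.
  apply: comb_eq_trans H _.
  have := comb_eq_sym (comb_eq_slideB (idm a) f (comb0 g)).
  by rewrite /= arr_mulE comp_idl htens_id comp_idl.
Qed.
End Combs.

(** * Recovering an optic from its cell *)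

Section Evaluation.
Variable A : strict_moncat.
Local Notation F := (free_cornering A).
Local Notation sqr := (square (@cell F)).
Local Notation bd := (@bd F).
Local Notation I := (@unit_ob A).

(** The action of a cell, through a chosen representative. *)
Definition sact (x : sqr) (s : seq (arrow (@hom A))) := act (rep (sq_cell x)) s.

Lemma sact_tcell X P Q Y (t : term X P Q Y) a b s : comb X a b s ->
  comb_eq Y (a ⊗ P) (b ⊗ Q) (sact (tcell t) s) (act t s).
Proof.
move=> Hs; apply: comb_eq_sym; apply: (act_sound (ceq_sym (ceq_rep t))) => //.
Qed.

Lemma sact_vc x y X P Q Y X' R Y' a m b u v :
  bd x X P Q Y -> bd y X' Q R Y' -> comb X a m u -> comb X' m b v ->
  comb_eq (Y ++ Y') (a ⊗ P) (b ⊗ R) (sact (vc x y) (star u v))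
    (star (sact x u) (sact y v)).
Proof.
move=> [c ->] [d ->] Hu Hv; rewrite vcE.
apply: comb_eq_trans (sact_tcell (Tvcomp (rep c) (rep d)) (comb_star Hu Hv)) _.
exact: act_vcomp Hu Hv.
Qed.

Lemma sact_gen a b (f : hom a b) : sact (gen f) [:: arr_id I] = [:: Arr f].
Proof.
rewrite (comb_eq0 (sact_tcell (Tgen f) (comb0 (idm I)))).
by rewrite [act _ _]/= arr_ten_unitl.
Qed.

Lemma sact_send M P :
  comb_eq P° (M ⊗ P) M (sact (send M P) [:: arr_id I]) [:: arr_id (M ⊗ P); arr_id M].
Proof.
rewrite /send -tcell_hcomp.
have : comb_eq P° (I ⊗ (M ⊗ P)) (I ⊗ (M ⊗ I)) _ _ :=
  sact_tcell (Thcomp (Tgen (idm M)) (TsendC P)) (comb0 (idm I)).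
rewrite [act _ _]/= -!/(arr_id _) !arr_ten_id.
by rewrite !ten_unitl ten_unitr.
Qed.

Lemma sact_recv M P :
  comb_eq P• M (M ⊗ P) (sact (recv M P) [:: arr_id I]) [:: arr_id M; arr_id (M ⊗ P)].
Proof.
rewrite /recv -tcell_hcomp.
have : comb_eq P• (I ⊗ (M ⊗ I)) (I ⊗ (M ⊗ P)) _ _ :=
  sact_tcell (Thcomp (Tgen (idm M)) (TrecvB P)) (comb0 (idm I)).
rewrite [act _ _]/= -!/(arr_id _) !arr_ten_id.
by rewrite !ten_unitl ten_unitr.
Qed.

(** The identity of the unit object is cut into four copies of itself, one for each
    layer of the cell. *)
Lemma sact_ocell P Q (x : preoptic P Q) :
  comb_eq (optic_boundary Q.1 Q.2) P.1 P.2 (sact (ocell x) [:: arr_id I])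
    [:: Arr (fwd x); arr_id (residual x); Arr (bwd x)].
Proof.
case: x => [M a b]; rewrite /ocell [residual _]/= [fwd _]/= [bwd _]/=.
have HI := comb0 (idm I).
have E : [:: arr_id I] = star [:: arr_id I] [:: arr_id I] by rewrite (star_idl HI).
have Hb := bd_gen b; have Hr := bd_recv M Q.2; have Hs := bd_send M Q.1.
have Hrb := bd_vc Hr Hb; have Hsrb := bd_vc Hs Hrb.
have E1 := sact_vc Hr Hb HI HI; have E2 := sact_vc Hs Hrb HI HI.
have E3 := sact_vc (bd_gen a) Hsrb HI HI.
rewrite -E !ten_unitl in E1 E2 E3.
apply: comb_eq_trans E3 _; rewrite sact_gen.
rewrite sact_gen in E1.
have {}E1 := comb_eq_trans E1 (comb_eq_starl (sact_recv M Q.2) (comb0 b)).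
have {}E2 := comb_eq_trans E2 (comb_eq_star (sact_send M Q.1) E1).
have := comb_eq_pre a E2.
by rewrite /= !arr_mulE !comp_idr !comp_idl.
Qed.

(** Which optic is represented by a comb on Q.1° ⊗ Q.2•.  This is a relation because
    the entries of a comb do not have prescribed types. *)
Definition decodes (P Q : A * A) (s : seq (arrow (@hom A))) (o : optic P Q) :=
  exists M N (f : hom P.1 (M ⊗ Q.1)) (g : hom M N) (h : hom (N ⊗ Q.2) P.2),
    s = [:: Arr f; Arr g; Arr h] /\
    o = cls _ (@PreOptic A P Q N (f ;; g ⊗₁ idm Q.1) h).

(** The middle arrow determines both intermediate objects, so the equality of
    lists forces all the data to agree. *)
Lemma decodes_fun P Q s (o o' : optic P Q) :
  decodes s o -> decodes s o' -> o = o'.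
Proof.
move=> [M [N [f [g [h [Es ->]]]]]] [M' [N' [f' [g' [h' [Es' ->]]]]]].
rewrite {}Es in Es'.
have ef : Arr f = Arr f' := congr1 (head (Arr f)) Es'.
have eg : Arr g = Arr g' := congr1 (fun s => head (Arr f) (behead s)) Es'.
have eh : Arr h = Arr h' := congr1 (last (Arr f)) Es'.
have eM : M = M' := congr1 (@arr_dom _ _) eg.
have eN : N = N' := congr1 (@arr_cod _ _) eg.
by subst M' N'; rewrite (arr_inj ef) (arr_inj eg) (arr_inj eh).
Qed.

Definition same_optic (P Q : A * A) (s s' : seq (arrow (@hom A))) :=
  exists o : optic P Q, decodes s o /\ decodes s' o.

Lemma same_optic_sym P Q s s' : same_optic P Q s s' -> same_optic P Q s' s.
Proof. by case=> o [? ?]; exists o. Qed.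

Lemma same_optic_trans P Q s1 s2 s3 :
  same_optic P Q s1 s2 -> same_optic P Q s2 s3 -> same_optic P Q s1 s3.
Proof.
by case=> o [H1 H2] [o' [H2' H3]]; exists o; rewrite {2}(decodes_fun H2 H2').
Qed.

Lemma same_optic_refl P Q s :
  comb (optic_boundary Q.1 Q.2) P.1 P.2 s -> same_optic P Q s s.
Proof.
move=> /combC_inv [M [f [s' [-> /combB1_inv [N [g [h ->]]]]]]].
by exists (cls _ (@PreOptic A P Q N (f ;; g ⊗₁ idm Q.1) h)); split;
  exists M, N, f, g, h.
Qed.

(** A slide along Q.2• is the slide of optics; the arrow f above the port Q.1° is
    carried along since the optic absorbs the middle arrow into it. *)
Lemma comb_eq_same_optic_tail (P Q : A * A) M s s' :
  comb_eq (port Q.2 bullet) M P.2 s s' ->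
  forall f : hom P.1 (M ⊗ Q.1), same_optic P Q (Arr f :: s) (Arr f :: s').
Proof.
move EX: (port _ _) => X; move Eb: P.2 => b H; elim: H EX Eb => {X M b s s'} //.
- move=> X M b s Hs EX Eb f; rewrite -{}EX -{}Eb in Hs.
  by apply: same_optic_refl; apply: combC.
- by move=> X M b s s' _ IH EX Eb f; apply: same_optic_sym; apply: IH.
- move=> X M b s1 s2 s3 _ IH1 _ IH2 EX Eb f.
  exact: same_optic_trans (IH1 EX Eb f) (IH2 EX Eb f).
- move=> R X M N b g s s' Hs _ [ER EX] Eb f.
  rewrite -{}EX -{}ER -{}Eb in Hs; rewrite -(comb_eq0 Hs).
  have [Hc _] := comb_eq_comb Hs; apply: same_optic_refl.
  by apply: combC; apply: combB; apply: Hc.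
- move=> R X M N K b g k s Hs [ER EX] Eb f; rewrite -{}EX -{}ER -{}Eb in Hs *.
  have [h ->] := comb0_inv Hs; rewrite /= arr_mulE.
  exists (cls _ (@PreOptic A P Q K (f ;; (g ;; k) ⊗₁ idm Q.1) h)); split.
    by exists M, K, f, (g ;; k), h.
  exists M, N, f, g, (k ⊗₁ idm Q.2 ;; h); split=> //; apply/clsP; apply: rst_step.
  rewrite -{1}(comp_idl (idm Q.1)) htens_comp -comp_assoc; exact: Slide.
Qed.

Lemma comb_eq_same_optic (Q : A * A) a b s s' :
  comb_eq (optic_boundary Q.1 Q.2) a b s s' -> same_optic (a, b) Q s s'.
Proof.
move EX: (optic_boundary _ _) => X H; elim: H EX => {X a b s s'} //.
- by move=> X a b s Hs EX; rewrite -{}EX in Hs; apply: same_optic_refl.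
- by move=> X a b s s' _ IH EX; apply: same_optic_sym; apply: IH.
- move=> X a b s1 s2 s3 _ IH1 _ IH2 EX.
  exact: same_optic_trans (IH1 EX) (IH2 EX).
- move=> R X a M b f s s' Hs _ [ER EX]; rewrite -{}EX -{}ER in f Hs *.
  exact: (@comb_eq_same_optic_tail (a, b) Q).
- move=> R X a M N b f k s Hs [ER EX]; rewrite -{}EX -{}ER in f Hs *.
  have [K [g [h ->]]] := combB1_inv Hs; rewrite /= arr_mulE.
  exists (cls _ (@PreOptic A (a, b) Q K ((f ;; k ⊗₁ idm Q.1) ;; g ⊗₁ idm Q.1) h)).
  split; first by exists N, K, (f ;; k ⊗₁ idm Q.1), g, h.
  exists M, K, f, (k ;; g), h; split=> //.
  by rewrite comp_assoc -htens_comp comp_idl.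
Qed.

(** Equal cells act alike on the identity of the unit object. *)
Lemma ocell_inj P Q (x y : preoptic P Q) :
  ocell x = ocell y -> cls (@slide A P Q) x = cls _ y.
Proof.
move=> E; have Hx := sact_ocell x; have Hy := sact_ocell y; rewrite -{}E in Hy.
have := comb_eq_same_optic (comb_eq_trans (comb_eq_sym Hx) Hy).
have dec (z : preoptic P Q) :
    @decodes (P.1, P.2) Q [:: Arr (fwd z); arr_id (residual z); Arr (bwd z)]
      (cls (@slide A (P.1, P.2) Q) (@PreOptic A (P.1, P.2) Q (residual z) (fwd z) (bwd z))).
  exists (residual z), (residual z), (fwd z), (idm _), (bwd z); split=> //.
  by rewrite htens_id comp_idr.
move=> [o [Ho Ho']].
have := etrans (esym (decodes_fun Ho (dec x))) (decodes_fun Ho' (dec y)).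
by clear; case: P x y => p1 p2 [M a b] [N c d].
Qed.

End Evaluation.

(** * The isomorphism *)

Section OpticFunctor.
Variable A : strict_moncat.
Local Notation F := (free_cornering A).

Definition optic_hcell P Q (x : preoptic P Q) :
    @hom (Hcat F) (optic_boundary P.1 P.2) (optic_boundary Q.1 Q.2) :=
  sval (bd_cell (bd_bend (bd_ocell x))).

Lemma Sq_optic_hcell P Q (x : preoptic P Q) :
  @Sq _ _ (@cell F) _ _ _ _ (optic_hcell x) = bend P (ocell x).
Proof. exact: svalP (bd_cell (bd_bend (bd_ocell x))). Qed.

Definition optic_ob (P : A * A) : optic_subcategory A :=
  exist _ (optic_boundary P.1 P.2) (ex_intro _ P.1 (ex_intro _ P.2 erefl)).

Definition optic_map (P Q : Optic A) (o : hom P Q) : hom (optic_ob P) (optic_ob Q) :=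
  optic_hcell (rep o).

Lemma Sq_optic_map P Q (x : preoptic P Q) :
  @Sq _ _ (@cell F) _ _ _ _ (@optic_map P Q (cls _ x)) = bend P (ocell x).
Proof.
rewrite Sq_optic_hcell; congr bend.
move: (rep _) (rep_cls (@slide A P Q) x) => y; elim=> {x y} //.
- exact: ocell_slide.
- by move=> u v w _ -> _.
Qed.

Lemma optic_map_id P : @optic_map P P (idm P) = idm (optic_ob P).
Proof. by apply: Sq_inj; rewrite Sq_optic_map ocell_id bend_bent. Qed.

Lemma optic_map_comp P Q R (f : @hom (Optic A) P Q) (g : hom Q R) :
  optic_map (f ;; g) = optic_map f ;; optic_map g.
Proof.
apply: Sq_inj; rewrite Sq_optic_map ocell_comp Sq_cast -hcE !Sq_optic_hcell.
by rewrite (hc_bend (bd_ocell _) (bd_bend (bd_ocell _))).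
Qed.

Definition optic_functor : functor (Optic A) (optic_subcategory A) :=
  Functor optic_map_id optic_map_comp.

Lemma optic_ob_surj X : exists P, optic_ob P = X.
Proof.
case: X => X [P [Q E]]; exists (P, Q); subst X.
by congr exist; apply: Prop_irrelevance.
Qed.

Definition optic_ob_inv (X : optic_subcategory A) : Optic A :=
  sval (cid (optic_ob_surj X)).

Lemma optic_ob_invK : cancel optic_ob_inv optic_ob.
Proof. by move=> X; apply: svalP (cid (optic_ob_surj X)). Qed.

Lemma optic_boundary_inj (P Q : A * A) :
  optic_boundary P.1 P.2 = optic_boundary Q.1 Q.2 -> P = Q.
Proof. by case: P Q => [a b] [c d] /= [-> ->]. Qed.

Lemma optic_obK : cancel optic_ob optic_ob_inv.
Proof.
move=> P; apply: optic_boundary_inj.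
exact: (congr1 sval (optic_ob_invK (optic_ob P))).
Qed.
End OpticFunctor.

Theorem theorem1 (A : strict_moncat) :
  exists F : functor (Optic A) (optic_subcategory A),
    is_cat_iso F /\
    forall P Q : A, proj1_sig (F (P, Q)) = optic_boundary P Q.
Proof.
exists (optic_functor A); split=> //.
apply: (@bijective_cat_iso _ _ (optic_functor A) _ (@optic_obK A) (@optic_ob_invK A)).
- move=> P Q o o' /= E; rewrite -[o]repK -[o']repK; apply: ocell_inj.
  rewrite -[LHS](bent_bend (bd_ocell _)) -[RHS](bent_bend (bd_ocell _)).
  by rewrite -!Sq_optic_hcell; congr (hc _ (Sq _)).
- move=> P Q c.
  have [x Ex] := @ocell_surj A P Q (Sq (c : @cell (free_cornering A) _ _ _ _)) (ex_intro _ c erefl).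
  exists (cls _ x); apply: Sq_inj; rewrite Sq_optic_map; exact: esym Ex.
Qed.
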